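(* $\Omega(\sqrt{s})\le \frac{s}{2}-d(s)\le O\bigl(\sqrt{s\log s}\bigr)$ as $s\to\infty$. That is, there exist absolute constants $c,C>0$ and $s_0$ such that for every integer $s\ge s_0$, $$c\sqrt{s}\le \frac{s}{2}-d(s)\le C\sqrt{s\log s}.$$
   Context: Digraphs are finite, without loops and without parallel arcs in the same direction (pairs of opposite arcs are allowed). The minimum out-degree of a digraph is the minimum over its vertices of the number of out-neighbours. For a positive integer $s$, $d(s)$ denotes the largest integer $d$ such that, for every positive integer $n$, every digraph on $2n$ vertices with minimum out-degree at least $s$ contains a subdigraph on $n$ vertices with minimum out-degree at least $d$. *)

(* Defs.v *)
From mathcomp Require Import all_boot.
From mathcomp Require Import boolp.

Set Implicit Arguments.
Unset Strict Implicit.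
Unset Printing Implicit Defensive.

(* A digraph whose vertices form a subset of an ambient finite type, so that  *)
(* a digraph and its subdigraphs have the same Rocq type. Since [arc] is a    *)
(* relation there are no parallel arcs; opposite arcs are allowed.            *)
Record digraph (T : finType) := Digraph {
  verts : {set T};
  arc : rel T;
  arc_verts : forall x y, arc x y -> (x \in verts) && (y \in verts);
  arc_irr : irreflexive arc
}.

Definition out_nbrs (T : finType) (G : digraph T) (x : T) : {set T} :=
  [set y | arc G x y].

(* The default value [#|verts G|] exceeds every out-degree, so it only        *)
(* matters for the digraph without vertices.                                  *)
Definition min_outdeg (T : finType) (G : digraph T) : nat :=
  \big[minn/#|verts G|]_(x in verts G) #|out_nbrs G x|.

Definition subdigraph (T : finType) (H G : digraph T) : Prop :=
  verts H \subset verts G /\ subrel (arc H) (arc G).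

Definition halving (s d : nat) : Prop :=
  forall n : nat, 0 < n ->
  forall (T : finType) (G : digraph T),
    #|verts G| = n.*2 -> s <= min_outdeg G ->
  exists H : digraph T,
    [/\ subdigraph H G, #|verts H| = n & d <= min_outdeg H].

Lemma leq_min_outdeg (T : finType) (G : digraph T) (d : nat) :
  0 < #|verts G| ->
  (d <= min_outdeg G) = [forall x in verts G, d <= #|out_nbrs G x|].
Proof.
move=> /card_gt0P[x0 x0G]; apply/idP/forall_inP => [dG x xG | dG].
  apply: leq_trans dG _; rewrite /min_outdeg unlock /=.
  elim: (index_enum T) (mem_index_enum x) => //= z r IHr.
  rewrite inE => /predU1P[<-|/IHr le_r]; first by rewrite xG geq_minl.
  by case: ifP => // _; apply: leq_trans (geq_minr _ _) le_r.
rewrite /min_outdeg; elim/big_ind: _ => [|m n dm dn|x /dG//].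
  apply: leq_trans (dG _ x0G) (subset_leq_card _).
  by apply/subsetP => y; rewrite inE => /arc_verts/andP[].
by rewrite leq_min dm.
Qed.

Lemma min_outdeg_le (T : finType) (G : digraph T) :
  min_outdeg G <= #|verts G|.
Proof.
rewrite /min_outdeg unlock /=; elim: (index_enum _) => //= x r IHr.
by case: ifP => // _; apply: leq_trans (geq_minr _ _) IHr.
Qed.

Lemma halving0 (s : nat) : halving s 0.
Proof.
move=> n _ T G cardG _.
have : 0 < #|[set A : {set T} | A \subset verts G & #|A| == n]|.
  by rewrite cards_draws cardG bin_gt0 -addnn leq_addr.
case/card_gt0P => A; rewrite inE => /andP[AG /eqP cardA].
have arcs0 (x y : T) : false -> (x \in A) && (y \in A) by [].
by exists (@Digraph T A (fun _ _ => false) arcs0 (fun => erefl)).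
Qed.

Lemma halving_bound (s d : nat) : halving s d -> d <= s.+1.
Proof.
pose T : finType := 'I_(s.+1).*2.
pose K := @Digraph T setT (fun x y => x != y)
  (fun x y _ => introT andP (conj (in_setT x) (in_setT y)))
  (fun x => negbF (eqxx x)).
have cardK : #|verts K| = (s.+1).*2 by rewrite cardsT card_ord.
move=> /(_ s.+1 isT T K cardK)[].
  rewrite leq_min_outdeg ?cardK //; apply/forall_inP => x _.
  have -> : out_nbrs K x = ~: [set x].
    by apply/setP => y; rewrite !inE eq_sym.
  by rewrite cardsC1 card_ord doubleS -addnn /= -addnS leq_addr.
by move=> H [_ cardH dH]; rewrite -cardH (leq_trans dH) ?min_outdeg_le.
Qed.

Fact halving_ex (s : nat) : exists d, `[< halving s d >].
Proof. by exists 0; apply/asboolP/halving0. Qed.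

Fact halving_ub (s d : nat) : `[< halving s d >] -> d <= s.+1.
Proof. by move/asboolP/halving_bound. Qed.

(* d(s): every d <= 0 has the halving property trivially, so the largest such *)
(* integer is the largest such natural number.                                *)
Definition dhalf (s : nat) : nat := ex_maxn (halving_ex s) (@halving_ub s).

Lemma dhalfP (s : nat) :
  halving s (dhalf s) /\ forall d, halving s d -> d <= dhalf s.
Proof.
rewrite /dhalf; case: ex_maxnP => m /asboolP hm max_m.
by split=> // d /asboolP/max_m.
Qed.

(* Main.v *)
Require Import Defs.
From mathcomp Require Import all_classical all_reals all_analysis.
From mathcomp Require Import all_boot all_order all_algebra.
From mathcomp Require Import zify ring lra.

(** Both inequalities come from fair coins, and the digraphs of the two
    directions are unrelated.

    Lower bound on d(s).  Trim every out-neighbourhood to exactly [s] vertices.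
    A uniformly random half of the vertices leaves a given vertex with fewer
    than [s/2 - C sqrt(s ln s)] out-neighbours with probability at most a
    large negative power of [s], by Chernoff ([agreements_tail]), so the local
    lemma ([local_lemma]) would conclude, but for two obstacles: in-degrees are
    unbounded, so that one coin may affect arbitrarily many vertices, and the
    half must have exactly [n] elements.  Both are removed in
    [halving_of_tail].  The few vertices of in-degree above [8 s^3] are all
    kept, which can only help; an equal number of vertices of small in-degree
    is discarded, chosen so that no vertex has two of them as out-neighbours
    ([sparse_subset]); the remaining vertices are paired, and a coin keeps one
    vertex of each pair.  This keeps exactly [n] vertices, and each coin now
    affects at most [16 s^3] of them.

    Upper bound on d(s).  Let [n = s + 1].  In the group of integers modulo
    [2n + 1], the triples [{a, b, c}] with [a + b + c = 0] cover each pair of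
    elements once, except for the pairs [{a, -2a}].  Orient each triple
    cyclically, in a direction chosen by a coin, and [a] towards [-2a].  All
    out-degrees of this tournament are [n], so that removing the vertex 0
    leaves [2n] vertices of out-degree at least [s].

    Fix a set [A] of [n] vertices.  A triple inside [A] does not affect the
    difference between out-degree and in-degree within [A], so that this
    difference at a vertex [v] is, up to the pairs [{a, -2a}], the sum of the
    coins of the triples which meet [A] in [v] and one other vertex: the
    imbalance of [v].  The imbalances of the vertices of [A] sum to 0.  Hence,
    if none of them is below [-w], their absolute values sum to at most [2nw],
    and most of them are [O(w)].  Now a positive proportion of the pairs of
    [A] has its third vertex outside [A] ([many_open]); otherwise [A] would be
    close to a coset of a subgroup of index 2, which a group of odd order does
    not have.  Tossing the coins vertex by vertex, order [n] of the vertices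
    see order [n] new coins, so each has imbalance [O(w)] with conditional
    probability [O(w / sqrt n)] ([rare_window]).  If [w] is a small enough
    multiple of [sqrt n], the probability that no imbalance is below [-w] is
    at most [8^-n] ([few_balanced]), while there are at most [2^(2n+1)] sets
    [A].  So some outcome of the coins gives every [A] a vertex of imbalance
    below [-w], that is, of out-degree at most [s/2] minus a multiple of
    [sqrt s] inside [A] ([halving_gap]). *)

Set Implicit Arguments.
Unset Strict Implicit.
Unset Printing Implicit Defensive.

Import Order.TTheory GRing.Theory Num.Theory.

(** * The union bound and the symmetric local lemma *)

Lemma leq_card_bigcup_sum (J T : finType) (B : {pred J}) (F : J -> {set T}) :
  #|\bigcup_(j in B) F j| <= \sum_(j in B) #|F j|.
Proof.
elim/big_ind2: _ => [|A m C n leA leC|//]; first by rewrite cards0.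
by apply: leq_trans (leq_of_leqif (leq_card_setU _ _)) (leq_add leA leC).
Qed.

Lemma leq_card_bigcup (J T : finType) (B : {pred J}) (F : J -> {set T}) m :
  {in B, forall j, #|F j| <= m} -> #|\bigcup_(j in B) F j| <= #|B| * m.
Proof.
by move=> Fm; apply: leq_trans (leq_card_bigcup_sum _ _) _;
  rewrite -sum_nat_const; apply: leq_sum.
Qed.

Section LocalLemma.
Variable I : finType.
Implicit Types (S X Y : {set I}) (E F : {set {set I}}).

Definition depends_on E S :=
  forall X Y, X :&: S = Y :&: S -> (X \in E) = (Y \in E).

Lemma depends_on_sub E S S' : S \subset S' -> depends_on E S -> depends_on E S'.
Proof.
move=> /setIidPr sSS' dE X Y eXY; apply: dE.
by rewrite -sSS' !setIA eXY.
Qed.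

(** Exchanging the coins of [S] between two independent samples is a bijection
    on pairs of samples; it turns the pairs whose first member lies in both
    events into those whose members lie in [E] and [F] respectively. *)
Lemma independent_card E F S :
  depends_on E S -> depends_on F (~: S) -> #|E :&: F| * 2 ^ #|I| = #|E| * #|F|.
Proof.
move=> dE dF.
pose mix X Y := (X :&: S) :|: (Y :\: S).
pose swap (u : {set I} * {set I}) := (mix u.1 u.2, mix u.2 u.1).
have swapK : involutive swap.
  by case=> X Y; congr (_, _); apply/setP => i; rewrite !inE; case: (i \in S);
    rewrite ?andbF ?andbT ?orbF.
have mixE X Y : (mix X Y \in E) = (X \in E).
  by apply: dE; apply/setP => i; rewrite !inE; case: (i \in S);
    rewrite ?andbF ?andbT ?orbF.
have mixF X Y : (mix X Y \in F) = (Y \in F).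
  by apply: dF; apply/setP => i; rewrite !inE; case: (i \in S);
    rewrite ?andbF ?andbT ?orbF.
rewrite -cardsT -card_powerset powersetT -!cardsX.
rewrite -(card_preimset _ (inv_inj swapK)); apply: eq_card => -[X Y].
by rewrite !inE /= mixE mixF andbT.
Qed.

Variable (V : finType) (E : V -> {set {set I}}) (S : V -> {set I}).
Variables (d q : nat).
Hypothesis E_dep : forall v, depends_on (E v) (S v).
Hypothesis E_rare : forall v, q * #|E v| <= 2 ^ #|I|.
Hypothesis few_deps : forall v, #|[set u | ~~ [disjoint S u & S v]]| <= d.
Hypothesis dq : 4 * d <= q.

Definition avoids (U : {set V}) : {set {set I}} :=
  [set X | [forall u in U, X \notin E u]].

Lemma avoids_dep (U : {set V}) (R : {set I}) :
  (forall u, u \in U -> S u \subset R) -> depends_on (avoids U) R.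
Proof.
move=> sUR X Y eXY; rewrite !inE; apply: eq_forallb_in => u uU.
by rewrite (depends_on_sub (sUR u uU) (@E_dep u) eXY).
Qed.

Lemma avoids_split (U W : {set V}) :
  #|avoids U| <= #|avoids (U :|: W)| + \sum_(w in W) #|E w :&: avoids U|.
Proof.
have sub : avoids U \subset avoids (U :|: W) :|: \bigcup_(w in W) (E w :&: avoids U).
  apply/subsetP => X XU; rewrite inE; case: (boolP (X \in avoids _)) => //=.
  move=> XUW; move: (XU); rewrite inE => /forall_inP XU'.
  move: XUW; rewrite inE negb_forall_in => /exists_inP[w]; rewrite negbK.
  case/setUP=> [/XU'/negP//|wW XE].
  by apply/bigcupP; exists w => //; rewrite inE XE.
apply: leq_trans (subset_leq_card sub) _.
apply: leq_trans (leq_of_leqif (leq_card_setU _ _)) _; rewrite leq_add2l.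
exact: leq_card_bigcup_sum.
Qed.

(** The induction at the heart of the local lemma: conditioning on avoiding
    any family of events at most doubles the bound on the probability of [E v].
    The events of the family that share no coin with [E v] are independent of
    it, and by induction the at most [d] others leave at least half of the
    samples that avoid these. *)
Lemma conditional_rare (U : {set V}) v : q * #|E v :&: avoids U| <= 2 * #|avoids U|.
Proof.
move: {2}_.+1 (ltnSn #|U|) => m; elim: m U v => // m IHm U v ltUm.
pose U1 := [set u in U | ~~ [disjoint S u & S v]].
pose U2 := [set u in U | [disjoint S u & S v]].
have UE : U = U2 :|: U1.
  by apply/setP => u; rewrite !inE; case: (u \in U); case: disjoint.
have indep : #|E v :&: avoids U2| * 2 ^ #|I| = #|E v| * #|avoids U2|.
  apply: (independent_card (@E_dep v)); apply: avoids_dep => u.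
  by rewrite inE -disjoints_subset => /andP[].
have le2 : q * #|E v :&: avoids U2| <= #|avoids U2|.
  rewrite -(leq_pmul2r (expn_gt0 2 #|I|)) -mulnA indep mulnA.
  by rewrite [_ * 2 ^ _]mulnC leq_mul2r E_rare orbT.
have leU : #|E v :&: avoids U| <= #|E v :&: avoids U2|.
  apply/subset_leq_card/setIS/subsetP => X; rewrite !inE => /forall_inP XU.
  by apply/forall_inP => u; rewrite inE => /andP[uU _]; apply: XU.
case: (eqVneq U1 set0) => [U10|U1n0].
  move: le2; rewrite UE U10 setU0; lia.
have ltU2 : #|U2| < m.
  have : #|U2| < #|U|; last lia.
  apply: proper_card; rewrite properE; apply/andP; split.
    by apply/subsetP => u; rewrite inE => /andP[].
  case/set0Pn: U1n0 => u; rewrite inE => /andP[uU nd]; apply/subsetPn; exists u => //.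
  by rewrite inE uU.
have := avoids_split U2 U1; rewrite -UE => split.
have: q * \sum_(w in U1) #|E w :&: avoids U2| <= d * (2 * #|avoids U2|).
  rewrite big_distrr /=; apply: (@leq_trans (\sum_(w in U1) 2 * #|avoids U2|)).
    by apply: leq_sum => w _; apply: IHm.
  rewrite sum_nat_const leq_mul2r (leq_trans _ (@few_deps v)) ?orbT //.
  by apply/subset_leq_card/subsetP => u; rewrite !inE => /andP[].
move: split le2 leU dq; set a := #|avoids U2|; set b := #|avoids U|.
set e := #|E v :&: avoids U2|; set e' := #|_ :&: _|; set s := \sum_(w in U1) _.
case: q => [|q']; nia.
Qed.

Lemma local_lemma : 2 < q -> exists X, forall v, X \notin E v.
Proof.
move=> q2.
have pos : forall m (U : {set V}), #|U| = m -> 0 < #|avoids U|.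
  elim=> [|m IHm] U Um.
    have -> : U = set0 by apply: cards0_eq.
    apply/card_gt0P; exists set0; rewrite inE; by apply/forall_inP => u; rewrite inE.
  have [u uU] : exists u, u \in U by apply/card_gt0P; rewrite Um.
  have := cardsD1 u U; rewrite uU Um add1n => -[/esym/IHm pU].
  have := avoids_split (U :\ u) [set u]; rewrite big_set1 setUC setD1K // => split.
  have := conditional_rare (U :\ u) u; nia.
have /card_gt0P[X] := pos _ setT erefl.
rewrite inE => /forall_inP XT; exists X => v; exact: XT.
Qed.

End LocalLemma.

(** * A Chernoff bound *)

Definition agreements (I : finType) (S K X : {set I}) : nat :=
  #|[set i in S | (i \in X) == (i \in K)]|.

Section Tail.
Local Open Scope ring_scope.

(** Instead of the usual exponential moment, a sample gets the weight
    [(1 - x) ^ agreements * (1 + x) ^ disagreements], whose total over all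
    samples is exactly [2 ^ #|I|]. *)
Lemma agreements_tail (R : realFieldType) (I : finType) (S K : {set I}) (s k : nat)
    (x : R) :
  0 <= x <= 1 -> (#|S| <= s)%N ->
  #|[set X | ((agreements S K X).*2 + k <= #|S|)%N]|%:R * ((1 + x) ^+ k * (1 - x ^+ 2) ^+ s)
    <= 2 ^+ #|I|.
Proof.
move=> /andP[x0 x1] leSs; have y0 : 0 <= 1 - x ^+ 2 <= 1 by apply/andP; split; nra.
pose F i : R := if i \in S then (if i \in K then 1 - x else 1 + x) else 1.
pose G i : R := if i \in S then (if i \in K then 1 + x else 1 - x) else 1.
have weightE (X : {set I}) : \prod_i (if i \in X then F i else G i) =
    (1 - x) ^+ agreements S K X * (1 + x) ^+ (#|S| - agreements S K X).
  rewrite (bigID (mem S)) /= [X in _ * X]big1 ?mulr1; last first.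
    by move=> i /negPf iS; rewrite /F /G iS if_same.
  rewrite (bigID (fun i => (i \in X) == (i \in K))) /=; congr (_ * _).
    rewrite (eq_bigr (fun=> 1 - x)); last first.
      by move=> i /andP[iS]; rewrite /F /G iS; case: (i \in X); case: (i \in K).
    by rewrite -big_set prodr_const.
  rewrite (eq_bigr (fun=> 1 + x)); last first.
    by move=> i /andP[iS]; rewrite /F /G iS; case: (i \in X); case: (i \in K).
  rewrite -big_set prodr_const; congr (_ ^+ _).
  have := cardsID [set i | (i \in X) == (i \in K)] S.
  rewrite /agreements (_ : S :&: _ = [set i in S | (i \in X) == (i \in K)]); last first.
    by apply/setP => i; rewrite !inE.
  rewrite (_ : S :\: _ = [set i in S | ~~ ((i \in X) == (i \in K))]); last first.
    by apply/setP => i; rewrite !inE andbC.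
  by move=> <-; rewrite addKn.
have <- : \sum_(X : {set I}) (1 - x) ^+ agreements S K X * (1 + x) ^+ (#|S| - agreements S K X)
    = 2 ^+ #|I|.
  under eq_bigr do rewrite -weightE.
  rewrite -bigA_distr -prodr_const; apply: eq_bigr => i _.
  rewrite /F /G /=; case: ifP => _; [case: ifP => _|]; ring.
rewrite mulr_natl -sumr_const [leRHS](bigID [pred X | ((agreements S K X).*2 + k <= #|S|)%N]) /=.
rewrite -[leLHS]addr0; apply: lerD; last first.
  by apply: sumr_ge0 => X _; apply: mulr_ge0; apply: exprn_ge0; lra.
rewrite big_set; apply: ler_sum => X /= few.
have -> : (#|S| - agreements S K X = (#|S| - (agreements S K X).*2) + agreements S K X)%N by lia.
rewrite exprD mulrCA -exprMn.
have -> : (1 - x) * (1 + x) = 1 - x ^+ 2 by ring.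
case/andP: y0 => y0 y1; apply: ler_pM; rewrite ?exprn_ge0 //; first lra.
- by rewrite ler_weXn2l //; [lra|lia].
- by rewrite ler_wiXn2l //; lia.
Qed.

End Tail.

(** * Auxiliary finite sets *)

Section SetSystem.
Variable T : finType.
Implicit Types (A V W Z H : {set T}).

Lemma exists_subset A m : m <= #|A| -> exists2 B : {set T}, B \subset A & #|B| = m.
Proof.
move=> mA; exists [set x in take m (enum A)].
  by apply/subsetP => x; rewrite inE => /mem_take; rewrite mem_enum.
rewrite cardsE; have /card_uniqP-> : uniq (take m (enum A)).
  by rewrite take_uniq // enum_uniq.
by rewrite size_takel // -cardE.
Qed.

Lemma pairing W m : #|W| = m.*2 ->
  exists (W1 : {set T}) (f : T -> T),
    [/\ W1 \subset W, #|W1| = m, {in W1 &, injective f} & f @: W1 = W :\: W1].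
Proof.
move=> Wm; have [W1 sW1 cW1] : exists2 B : {set T}, B \subset W & #|B| = m.
  by apply: exists_subset; rewrite Wm -addnn leq_addr.
have cW2 : #|W :\: W1| = m by rewrite cardsD (setIidPr sW1) Wm cW1; lia.
pose f x := nth x (enum (W :\: W1)) (index x (enum W1)).
have ltf x : x \in W1 -> index x (enum W1) < size (enum (W :\: W1)).
  by move=> xW; rewrite -cardE cW2 -cW1 cardE index_mem mem_enum.
have injf : {in W1 &, injective f}.
  move=> x y xW yW; rewrite /f (set_nth_default y) ?ltf // => /eqP.
  rewrite nth_uniq ?ltf ?enum_uniq // => /eqP/(congr1 (nth x (enum W1))).
  by rewrite !nth_index ?mem_enum.
exists W1, f; split => //; apply/eqP; rewrite eqEcard card_in_imset // cW1 cW2 leqnn andbT.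
by apply/subsetP => _ /imsetP[x xW ->]; rewrite -mem_enum mem_nth // ltf.
Qed.

Variable N : T -> {set T}.
Definition indeg u := #|[set v | u \in N v]|.

Lemma sum_indeg : \sum_u indeg u = \sum_v #|N v|.
Proof.
rewrite /indeg; under eq_bigr do rewrite -sum1_card big_set big_mkcond /=.
rewrite exchange_big; apply: eq_bigr => v _.
by rewrite -big_mkcond /= sum1_card.
Qed.

Lemma card_large_indeg D (H : {set T}) :
  {in H, forall u, D <= indeg u} -> #|H| * D <= \sum_v #|N v|.
Proof.
move=> largeH; rewrite -sum_indeg (bigID (mem H)) /=.
by apply: leq_trans (leq_addr _ _); rewrite -sum_nat_const; apply: leq_sum.
Qed.

(** A maximal set [Z] of this kind is large: every other element of [U] shares
    a set [N v] with some element of [Z], and an element of [Z] excludes at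
    most [D * s] elements in this way. *)
Lemma sparse_subset (U : {set T}) s D :
  (forall v, #|N v| <= s) -> {in U, forall u, indeg u <= D} ->
  exists Z : {set T}, [/\ Z \subset U, forall v, #|N v :&: Z| <= 1
    & #|U| <= #|Z| * (D * s).+1].
Proof.
move=> Ns UD; pose P Z := (Z \subset U) && [forall v, #|N v :&: Z| <= 1].
have P0 : P set0.
  by rewrite /P sub0set; apply/forallP => v; rewrite setI0 cards0.
have [Z /maxsetP[/andP[sZU /forallP Z1] maxZ]] := @ex_maxset T P (ex_intro _ set0 P0).
exists Z; split => //; rewrite mulnS.
have sub : U \subset Z :|: \bigcup_(z in Z) \bigcup_(v in [set v | z \in N v]) N v.
  apply/subsetP => u uU; rewrite inE; case: (boolP (u \in Z)) => //= nuZ.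
  have : ~~ P (u |: Z).
    by apply: contra nuZ => /maxZ <-; rewrite ?setU11 ?subsetUr.
  rewrite /P subUset sub1set uU sZU negb_forall => /existsP[v]; rewrite -ltnNge => lt1.
  have uv : u \in N v.
    apply: contraLR lt1 => nuv; rewrite -leqNgt (_ : N v :&: _ = N v :&: Z) ?Z1 //.
    by apply/setP => x; rewrite !inE; case: eqP => [->|//]; rewrite (negPf nuv).
  have : 0 < #|N v :&: Z|.
    have: #|N v :&: (u |: Z)| <= #|[set u]| + #|N v :&: Z|.
      apply: leq_trans (leq_of_leqif (leq_card_setU _ _)).
      by apply/subset_leq_card/subsetP => x; rewrite !inE; case: eqP => //=.
    by rewrite cards1; lia.
  case/card_gt0P => z; rewrite inE => /andP[zv zZ].
  by apply/bigcupP; exists z => //; apply/bigcupP; exists v => //; rewrite inE.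
apply: leq_trans (subset_leq_card sub) _.
apply: leq_trans (leq_of_leqif (leq_card_setU _ _)) _; rewrite leq_add2l.
apply: leq_card_bigcup => z zZ; apply: leq_trans (leq_card_bigcup _) _ => //.
by rewrite leq_mul2r; apply/orP; right; apply: UD; apply: (subsetP sZU).
Qed.

End SetSystem.

(** * Halving a digraph *)

(** Each coin of the choice below affects at most [16 s^3] vertices, and each
    vertex looks at [s] coins at most, so that the local lemma asks for bad
    events of probability at most [1 / (4 * 16 s^4)]. *)
Definition rare_tail (s k : nat) := forall (I : finType) (S K : {set I}),
  #|S| <= s ->
  64 * s ^ 4 * #|[set X | (agreements S K X).*2 + k <= #|S|]| <= 2 ^ #|I|.

Section Balanced.
Variables (T : finType) (N : T -> {set T}) (W1 : {set T}) (f : T -> T).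
Hypotheses (f_inj : {in W1 &, injective f}) (W1fW1 : [disjoint W1 & f @: W1]).

(** The pair of [i] in [W1] is [{i, f i}].  A pair contained in [N v] always
    contributes 1 to the number of chosen elements of [N v], so that only the
    pairs split by [N v] are random. *)
Definition split_pairs v : {set T} := [set i in W1 | (i \in N v) != (f i \in N v)].

Definition chosen (X : {set T}) : {set T} := (W1 :&: X) :|: f @: (W1 :\: X).

Lemma card_in_chosen v (X : {set T}) :
  #|N v :&: chosen X| =
    #|[set i in W1 | (i \in N v) && (f i \in N v)]| + agreements (split_pairs v) (N v) X.
Proof.
have -> : #|N v :&: chosen X| = #|[set i in W1 | if i \in X then i \in N v else f i \in N v]|.
  rewrite /chosen setIUr cardsU (_ : _ :&: _ :&: (_ :&: _) = set0) ?cards0 ?subn0; last first.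
    apply/eqP; rewrite setI_eq0 disjoint_subset; apply/subsetP => x.
    rewrite !inE => /and3P[_ xW _]; apply: contraL xW => /andP[_ xf].
    apply: contraL (xf) => /(disjointFr W1fW1) xf'; apply/negP.
    by move=> /imsetP[y]; rewrite inE => /andP[_ yW] e; move: xf'; rewrite e imset_f.
  have -> : N v :&: f @: (W1 :\: X) = f @: [set i in W1 :\: X | f i \in N v].
    apply/setP => y; rewrite inE; apply/andP/imsetP => [[yN /imsetP[x xW e]]|[x]].
      by exists x; rewrite // inE xW -e.
    by rewrite inE => /andP[xW fxN] ->; rewrite fxN imset_f.
  rewrite card_in_imset; last first.
    move=> x y; rewrite !inE => /andP[/andP[_ xW] _] /andP[/andP[_ yW] _].
    exact: f_inj.
  rewrite -(cardsID X [set i in W1 | _]); congr (_ + _); apply: eq_card => i; rewrite !inE.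
    by case: (i \in X); rewrite ?andbF ?andbT // andbC.
  by case: (i \in X).
rewrite /agreements -(cardsID [set i | (i \in N v) && (f i \in N v)] [set i in W1 | _]).
congr (_ + _); apply: eq_card => i; rewrite !inE.
  by case: (i \in W1); case: (i \in X); case: (i \in N v); case: (f i \in N v).
by case: (i \in W1); case: (i \in X); case: (i \in N v); case: (f i \in N v).
Qed.

Lemma card_pairs v :
  #|N v :&: (W1 :|: f @: W1)| =
    #|[set i in W1 | (i \in N v) && (f i \in N v)]|.*2 + #|split_pairs v|.
Proof.
have -> : #|N v :&: (W1 :|: f @: W1)| =
    #|[set i in W1 | i \in N v]| + #|[set i in W1 | f i \in N v]|.
  rewrite setIUr cardsU (_ : _ :&: _ :&: (_ :&: _) = set0) ?cards0 ?subn0; last first.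
    by apply/eqP; rewrite setI_eq0; apply: disjointWl (subsetIr _ _) _;
      rewrite disjoint_sym; apply: disjointWl (subsetIr _ _) _; rewrite disjoint_sym.
  congr (_ + _); first by apply: eq_card => i; rewrite !inE andbC.
  rewrite -[RHS](card_in_imset (f := f)); last first.
    by move=> x y; rewrite !inE => /andP[xW _] /andP[yW _]; apply: f_inj.
  apply: eq_card => y; rewrite inE; apply/andP/imsetP => [[yN /imsetP[x xW e]]|[x]].
    by exists x; rewrite // inE xW -e.
  by rewrite inE => /andP[xW fxN] ->; rewrite fxN imset_f.
pose P := [set i | i \in N v]; pose Q := [set i | f i \in N v].
rewrite -(cardsID Q [set i in W1 | i \in N v]) -(cardsID P [set i in W1 | f i \in N v]).
rewrite /split_pairs -(cardsID P [set i in W1 | _ != _]).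
set a := #|_|; set b := #|_|; set c := #|_|; set d := #|_|; set e := #|_|.
set g := #|_|; set h := #|_|.
have -> : a = e by apply: eq_card => i; rewrite !inE -andbA.
have -> : c = e by apply: eq_card => i; rewrite !inE -andbA [(f i \in _) && _]andbC.
have -> : b = g.
  by apply: eq_card => i; rewrite !inE; case: (i \in W1); case: (i \in N v); case: (f i \in N v).
have -> : d = h.
  by apply: eq_card => i; rewrite !inE; case: (i \in W1); case: (i \in N v); case: (f i \in N v).
lia.
Qed.

Variables s k : nat.
Hypotheses (s_gt0 : 0 < s) (rare : rare_tail s k).
Hypothesis N_s : forall v, #|N v| <= s.
Hypothesis W_D : {in W1 :|: f @: W1, forall u, indeg N u <= 8 * s ^ 3}.

Lemma balanced_choice : exists X : {set T}, forall v,
  #|split_pairs v| < (agreements (split_pairs v) (N v) X).*2 + k.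
Proof.
pose E v := [set X | (agreements (split_pairs v) (N v) X).*2 + k <= #|split_pairs v|].
have split_s v : #|split_pairs v| <= s.
  apply: leq_trans (N_s v); apply: leq_trans (subset_leq_card (subsetIl (N v) (W1 :|: f @: W1))).
  by rewrite card_pairs leq_addl.
have Edep v : depends_on (E v) (split_pairs v).
  move=> X Y eXY; rewrite !inE; congr (_.*2 + _ <= _); apply: eq_card => i.
  rewrite !inE; move/setP/(_ i): eXY; rewrite !inE.
  by case: (i \in W1); case: ((i \in N v) != (f i \in N v)); rewrite /= ?andbT ?andbF // => ->.
have Erare v : 64 * s ^ 4 * #|E v| <= 2 ^ #|T| by apply: rare.
have deps v : #|[set u | ~~ [disjoint split_pairs u & split_pairs v]]| <= 16 * s ^ 4.
  have sub : [set u | ~~ [disjoint split_pairs u & split_pairs v]] \subset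
      \bigcup_(i in split_pairs v) ([set u | i \in N u] :|: [set u | f i \in N u]).
    apply/subsetP => u; rewrite inE -setI_eq0 => /set0Pn[i]; rewrite inE => /andP[iu iv].
    apply/bigcupP; exists i => //; move: iu; rewrite !inE => /andP[_].
    by case: (i \in N u) => //=; case: (f i \in N u).
  apply: leq_trans (subset_leq_card sub) _.
  apply: leq_trans (leq_card_bigcup (m := 16 * s ^ 3) _) _.
    move=> i; rewrite inE => /andP[iW _].
    apply: leq_trans (leq_of_leqif (leq_card_setU _ _)) _.
    have W1i := W_D; have := W1i i; have := W1i (f i); rewrite /indeg !inE iW imset_f // orbT.
    move=> /(_ isT) + /(_ isT); lia.
  have := split_s v; rewrite (expnS s 3); nia.
have [||X HX] := local_lemma Edep Erare deps.
  by rewrite mulnA.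
  by have := expn_gt0 s 4; rewrite s_gt0 /=; lia.
by exists X => v; move: (HX v); rewrite inE -ltnNge.
Qed.

End Balanced.

(** The trimmed out-neighbourhoods [N v] have [s] elements, so that the
    in-degrees sum to [2ns].  This bounds the set [H] of kept vertices by
    [n / (4 s^2)], and shows that the set [U] of vertices of in-degree at most
    [4s] has at least [3n/2] elements, which leaves room for the set [Z] of
    discarded vertices.  Discarding costs a vertex at most one out-neighbour. *)
Lemma halving_of_tail s k d :
  0 < s -> rare_tail s k -> d.*2 + k <= s -> halving s d.
Proof.
move=> s0 rare dks.
have arith h z w e p t a : p < t.*2 + k -> z <= 1 -> s = h + z + w ->
    w = e.*2 + p -> a = h + (e + t) -> d <= a by lia.
move=> n n0 T G cardG minG; set V := verts G in cardG.
have V0 : 0 < #|verts G| by rewrite cardG double_gt0.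
move: minG; rewrite leq_min_outdeg // => /forall_inP minG.
have [N N_sub N_s] : exists2 N : T -> {set T}, forall v, N v \subset out_nbrs G v
    & forall v, #|N v| = if v \in V then s else 0.
  exists (fun v => [set x in take s (enum (out_nbrs G v))]) => v.
    by apply/subsetP => x; rewrite inE => /mem_take; rewrite mem_enum.
  rewrite cardsE; have /card_uniqP-> : uniq (take s (enum (out_nbrs G v))).
    by rewrite take_uniq // enum_uniq.
  case: ifP => [/minG vs|nvV]; first by rewrite size_takel // -cardE.
  rewrite (_ : out_nbrs G v = set0) ?enum_set0 //.
  by apply/setP => x; rewrite !inE; apply/negP => /arc_verts; rewrite -/V nvV.
have NV v : N v \subset V.
  by apply: subset_trans (N_sub v) _; apply/subsetP => x; rewrite inE => /arc_verts/andP[].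
have N_le v : #|N v| <= s by rewrite N_s; case: ifP.
have sumN : \sum_v #|N v| = n.*2 * s.
  by under eq_bigr do rewrite N_s; rewrite -big_mkcond /= sum_nat_const cardG.
pose H := [set u in V | 8 * s ^ 3 < indeg N u].
pose U := [set u in V | indeg N u <= 4 * s].
have Hle : #|H| * (8 * s ^ 3) <= n.*2 * s.
  by rewrite -sumN; apply: card_large_indeg => u; rewrite inE => /andP[_ /ltnW].
have VUle : #|V :\: U| * (4 * s) <= n.*2 * s.
  rewrite -sumN; apply: card_large_indeg => u; rewrite !inE => /andP[+ uV].
  by rewrite uV -ltnNge => /ltnW.
have Ule : n.*2 <= #|U| + #|V :\: U|.
  rewrite -cardG -(cardsID U V) leq_add2r subset_leq_card //; exact: subsetIr.
have [|Z0 [Z0U Z01 cZ0]] := @sparse_subset T N U s (4 * s) N_le.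
  by move=> u; rewrite inE => /andP[].
have hZ0 : #|H| <= #|Z0|.
  have {}Hle : #|H| * (4 * (s * s)) <= n.
    rewrite -(leq_pmul2r s0); move: Hle; rewrite !expnS expn0; nia.
  have {}VUle : #|V :\: U|.*2 <= n by rewrite -(leq_pmul2r s0); nia.
  rewrite leqNgt; apply/negP => ltZ; move: cZ0 ltZ Hle VUle Ule.
  set z := #|Z0|; set h := #|H|; set u := #|U|; set w := #|_ :\: _| => *.
  have : z * (4 * s * s).+1 <= z * (5 * (s * s)) by rewrite leq_mul2l; apply/orP; right; nia.
  have : z.+1 * (4 * (s * s)) <= h * (4 * (s * s)) by rewrite leq_mul2r orbC; apply/orP; left.
  have : 0 < s * s by rewrite muln_gt0 s0.
  nia.
have [Z ZZ0 cZ] := exists_subset hZ0.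
have ZU := subset_trans ZZ0 Z0U.
have UV : U \subset V by apply/subsetP => u; rewrite inE => /andP[].
have HV : H \subset V by apply/subsetP => u; rewrite inE => /andP[].
have Z1 v : #|N v :&: Z| <= 1 by apply: leq_trans (Z01 v); apply/subset_leq_card/setIS.
have HZ : [disjoint H & Z].
  rewrite disjoint_subset; apply/subsetP => u; rewrite !inE => /andP[_ lu].
  apply: contraL lu => /(subsetP ZU); rewrite inE -leqNgt => /andP[_] le4.
  apply: leq_trans le4 _; have : 0 < s ^ 2 by rewrite expn_gt0 s0.
  by rewrite (expnS s 2); nia.
pose W := V :\: (H :|: Z).
have HZV : H :|: Z \subset V by rewrite subUset HV (subset_trans ZU UV).
have cHZ : #|H :|: Z| = #|H|.*2.
  by rewrite cardsU (disjoint_setI0 HZ) cards0 subn0 cZ addnn.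
have leHn : #|H| <= n by rewrite -leq_double -cHZ -cardG subset_leq_card.
have cW : #|W| = (n - #|H|).*2.
  by rewrite cardsD (setIidPr HZV) cardG cHZ doubleB.
(* The number of remaining vertices is even because [H] and [Z] have equal sizes. *)
have [W1 [f [W1W cW1 injf fW1]]] := pairing cW.
have W1f : [disjoint W1 & f @: W1] by rewrite fW1 -setI_eq0 setDE setICA setICr setI0.
have W1UW : W1 :|: f @: W1 = W.
  by rewrite fW1 setDE setUIr setUCr setIT; apply/setUidPr.
have WD : {in W1 :|: f @: W1, forall u, indeg N u <= 8 * s ^ 3}.
  rewrite W1UW => u; rewrite !inE negb_or -andbA => /and3P[+ _ uV].
  by rewrite uV -leqNgt.
have [X HX] := balanced_choice injf W1f s0 rare N_le WD.
pose A := H :|: chosen W1 f X.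
have chosenW : chosen W1 f X \subset W.
  by rewrite -W1UW; apply: setUSS; [apply: subsetIl | apply/imsetS/subsetDl].
have HW : [disjoint H & W].
  by rewrite disjoint_subset; apply/subsetP => u uH; rewrite inE in_setD in_setU uH.
have AV : A \subset V by rewrite subUset HV (subset_trans chosenW (subsetDl _ _)).
have cA : #|A| = n.
  rewrite /A cardsU disjoint_setI0 ?cards0 ?subn0; last exact: disjointWr chosenW HW.
  rewrite /chosen cardsU [(W1 :&: X) :&: _]disjoint_setI0 ?cards0 ?subn0; last first.
    by apply: disjointWl (subsetIl _ _) _; apply: disjointWr W1f; apply/imsetS/subsetDl.
  rewrite card_in_imset; last by move=> x y; rewrite !inE => /andP[_ ?] /andP[_ ?]; exact: injf.
  by rewrite cardsID cW1 subnKC.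
have degA v : v \in V -> d <= #|N v :&: A|.
  move=> vV; have := N_s v; rewrite vV => Nvs.
  apply: (arith #|N v :&: H| #|N v :&: Z| #|N v :&: W| _ _ _ _ (HX v) (Z1 v)).
  - rewrite -Nvs -(cardsID (H :|: Z) (N v)); congr (_ + _).
      rewrite setIUr cardsU [(N v :&: H) :&: _]disjoint_setI0 ?cards0 ?subn0 //.
      by apply: disjointWl (subsetIr _ _) _; apply: disjointWr (subsetIr _ _) _.
    by rewrite /W setIDA (setIidPl (NV v)).
  - by rewrite -/W -W1UW card_pairs.
  rewrite -card_in_chosen // setIUr cardsU [(N v :&: H) :&: _]disjoint_setI0 ?cards0 ?subn0 //.
  apply: disjointWl (subsetIr _ _) _; apply: disjointWr (subsetIr _ _) _.
  exact: disjointWr chosenW HW.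
pose arcA : rel T := fun x y => [&& Defs.arc G x y, x \in A & y \in A].
have arcA_verts x y : arcA x y -> (x \in A) && (y \in A) by case/and3P=> _ -> ->.
have arcA_irr : irreflexive arcA by move=> x; rewrite /arcA arc_irr.
exists (Digraph arcA_verts arcA_irr); split => //.
  by split => // x y /and3P[].
rewrite leq_min_outdeg ?cA //; apply/forall_inP => x xA.
apply: leq_trans (degA x (subsetP AV x xA)) (subset_leq_card _).
apply/subsetP => y; rewrite in_setI => /andP[yN yA].
by have := subsetP (N_sub x) y yN; rewrite !inE /= /arcA xA yA andbT => ->.
Qed.

(** * The asymptotic lower bound on d(s) *)

Section UpperBound.
Local Open Scope ring_scope.
Variable R : realType.
Implicit Types x y : R.

Lemma expR_le_1Dx x : 0 <= x <= 1 -> expR (x / 2) <= 1 + x.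
Proof.
move=> /andP[x0 x1]; rewrite -[x / 2]opprK expRN.
have h : 1 - x / 2 <= expR (- (x / 2)) by exact: expR_ge1Dx.
have p : 0 < expR (- (x / 2)) by exact: expR_gt0.
by rewrite -[_^-1]mul1r ler_pdivrMr //; nra.
Qed.

Lemma expRN_le_1Bx y : 0 <= y <= 2^-1 -> expR (- (2 * y)) <= 1 - y.
Proof.
move=> /andP[y0 y1]; rewrite expRN.
have h : 1 + 2 * y <= expR (2 * y) by exact: expR_ge1Dx.
have p : 0 < expR (2 * y) by exact: expR_gt0.
by rewrite -[_^-1]mul1r ler_pdivrMr //; nra.
Qed.

(** The choice [x = sqrt (ln s / s)] turns the weight in [agreements_tail]
    into at least [s^7 * s^-2], which is at least [64 s^4]. *)
Lemma rare_tail_ln (s k : nat) :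
  (64 <= s)%N -> 14 * Num.sqrt (s%:R * ln s%:R) <= k%:R :> R -> rare_tail s k.
Proof.
move=> s64; set L := Num.sqrt _ => Lk I S K Ss; set c := #|_|.
have s1 : 64 <= s%:R :> R by rewrite ler_nat.
have s0 : 0 < s%:R :> R by lra.
have l0 : 0 <= ln s%:R :> R by apply: ln_ge0; lra.
have lh : ln s%:R <= s%:R / 2 :> R.
  rewrite (_ : s%:R = (1 + 1) * (1 + (s%:R / 2 - 1))); last by lra.
  rewrite lnM ?posrE; [|lra|lra].
  have : ln (1 + 1) <= 1 :> R by apply: le_ln1Dx; lra.
  have : ln (1 + (s%:R / 2 - 1)) <= s%:R / 2 - 1 :> R by apply: le_ln1Dx; lra.
  lra.
have L2 : L ^+ 2 = s%:R * ln s%:R by rewrite sqr_sqrtr // mulr_ge0 // ltW.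
have L0 : 0 <= L by exact: sqrtr_ge0.
pose x := L / s%:R.
have xL : x * L = ln s%:R by rewrite /x mulrAC -expr2 L2 mulrC mulKf // gt_eqF.
have xx : s%:R * x ^+ 2 = ln s%:R by rewrite expr2 /x mulrA [s%:R * _]mulrC divfK ?gt_eqF // mulrC.
have x0 : 0 <= x by apply: divr_ge0 => //; lra.
have x2 : x ^+ 2 <= 2^-1 by rewrite -(ler_pM2l s0) xx.
have x1 : x <= 1 by nra.
have := @agreements_tail R I S K s k x; rewrite x0 x1 => /(_ isT Ss); rewrite -/c => tail.
have big : 64 * s%:R ^+ 4 <= (1 + x) ^+ k * (1 - x ^+ 2) ^+ s.
  have p1 : expR (7 * ln s%:R) <= (1 + x) ^+ k.
    apply: (@le_trans _ _ (expR (x / 2) ^+ k)).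
      rewrite -expRM_natl ler_expR -xL.
      by have := ler_wpM2r x0 Lk; lra.
    apply: lerXn2r; rewrite ?nnegrE ?expR_ge0 //; first lra.
    by apply: expR_le_1Dx; rewrite x0.
  have p2 : expR (- (2 * ln s%:R)) <= (1 - x ^+ 2) ^+ s.
    apply: (@le_trans _ _ (expR (- (2 * x ^+ 2)) ^+ s)).
      by rewrite -expRM_natl ler_expR -xx; lra.
    apply: lerXn2r; rewrite ?nnegrE ?expR_ge0 //; first lra.
    by apply: expRN_le_1Bx; rewrite sqr_ge0.
  apply: le_trans (ler_pM (expR_ge0 _) (expR_ge0 _) p1 p2).
  rewrite -expRD (_ : _ + _ = 5%:R * ln s%:R); last by lra.
  rewrite expRM_natl lnK ?posrE // [leRHS]exprS; exact: ler_wpM2r.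
rewrite -(ler_nat R) !natrM !natrX mulrC; apply: le_trans tail.
by rewrite ler_wpM2l.
Qed.

Lemma dhalf_lower_bound (s : nat) : (64 <= s)%N ->
  s%:R / 2 - (dhalf s)%:R <= 8 * Num.sqrt (s%:R * ln s%:R) :> R.
Proof.
move=> s64; set L := Num.sqrt _; pose k := (Num.truncn (14 * L)).+1.
have L0 : 0 <= 14 * L by rewrite mulr_ge0 // sqrtr_ge0.
have /andP[kL Lk] := truncn_itv L0.
have rare : rare_tail s k by apply: rare_tail_ln => //; apply: ltW.
have {kL Lk} kL : k%:R <= 14 * L + 1 by rewrite /k -natr1 lerD2r.
move: k rare kL => k rare kL.
have s1 : 64 <= s%:R :> R by rewrite ler_nat.
have s0 : 0 < s%:R :> R by lra.
have L1 : 1 <= L.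
  rewrite -[1]sqrtr1 ler_wsqrtr //.
  have : ln (1 + (s%:R^-1 - 1)) <= s%:R^-1 - 1 :> R.
    by apply: le_ln1Dx; rewrite ltrBrDr addrC subrr invr_gt0.
  rewrite addrC subrK lnV ?posrE //.
  have : s%:R^-1 <= 64^-1 :> R by rewrite lef_pV2 ?posrE.
  nra.
have d0 : 0 <= (dhalf s)%:R :> R by [].
have [ks|sk] := leqP k s; last first.
  have : s%:R <= k%:R :> R by rewrite ler_nat ltnW.
  lra.
have hd : halving s (s - k)./2.
  by apply: (halving_of_tail _ rare); [lia|lia].
have := (dhalfP s).2 _ hd; rewrite -(ler_nat R) => led.
have : (s%:R <= ((s - k)./2).*2%:R + k%:R + 1 :> R) by rewrite -natrD natr1 ler_nat; lia.
rewrite -muln2 natrM; lra.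
Qed.
End UpperBound.

(** * Resampling disjoint blocks of coins *)

Lemma leq_bin_half n j : 'C(n, j) <= 'C(n, n./2).
Proof.
have low i : i <= n./2 -> 'C(n, n./2 - i) <= 'C(n, n./2).
  elim: i => [|i IHi] lti; first by rewrite subn0.
  apply: leq_trans (IHi (ltnW lti)).
  have := mul_bin_left n (n./2 - i.+1); rewrite -subSn // subSS.
  set a := 'C(_, _); set b := 'C(_, _) => e.
  rewrite -(@leq_pmul2l (n./2 - i)); last by rewrite subn_gt0.
  rewrite e leq_mul2r; apply/orP; right; lia.
have [jn|nj] := leqP j n./2; first by rewrite -(subKn jn) low // leq_subr.
have [jn|nj'] := leqP j n; last by rewrite bin_small.
rewrite -bin_sub // (_ : n - j = n./2 - (n./2 - (n - j))); last lia.
by rewrite low // leq_subr.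
Qed.

Lemma bin_double m : m.+1 * 'C(m.*2.+1, m) = m.*2.+1 * 'C(m.*2, m).
Proof.
have := mul_bin_down m.*2.+1 m => /= ->; congr (_ * _); lia.
Qed.

Lemma bin_doubleS m : 'C(m.+1.*2, m.+1) = 2 * 'C(m.*2.+1, m).
Proof.
have := mul_bin_diag m.+1.*2 m; rewrite doubleS /= -doubleS -muln2.
by rewrite -mulnA => /eqP; rewrite eqn_pmul2l // => /eqP.
Qed.

Lemma central_bin m : 'C(m.*2, m) ^ 2 * m.*2.+1 <= 16 ^ m.
Proof.
elim: m => [//|m IH]; rewrite bin_doubleS !expnS expn0 !muln1 -(@leq_pmul2l (m.+1 * m.+1)) //.
have := bin_double m; set c := 'C(m.*2, m); set c1 := 'C(_, _); set p := 16 ^ m => e.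
have -> : m.+1 * m.+1 * (2 * c1 * (2 * c1) * m.+1.*2.+1) =
    4 * m.+1.*2.+1 * ((m.+1 * c1) * (m.+1 * c1)) by lia.
rewrite e.
have -> : 4 * m.+1.*2.+1 * (m.*2.+1 * c * (m.*2.+1 * c)) =
    4 * m.+1.*2.+1 * m.*2.+1 * (c * c * m.*2.+1) by lia.
apply: (@leq_trans (4 * m.+1.*2.+1 * m.*2.+1 * p)); first by rewrite leq_mul2l IH orbT.
rewrite [leqRHS]mulnA leq_mul2r; apply/orP; right; lia.
Qed.

(** The largest binomial coefficient is [O(2^f / sqrt f)]; squaring keeps the
    estimate in the natural numbers. *)
Lemma bin_bound f j : 'C(f, j) ^ 2 * f <= 4 ^ f.
Proof.
apply: leq_trans (_ : 'C(f, f./2) ^ 2 * f <= _).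
  by rewrite leq_mul2r leq_sqr leq_bin_half orbT.
have four m : 4 ^ m.*2 = 16 ^ m by rewrite -muln2 mulnC expnM.
have := central_bin f./2; have := central_bin f./2.+1; rewrite bin_doubleS !expnS !expn0 !muln1.
rewrite -[in 'C(f, _)](odd_double_half f) -[X in 4 ^ X](odd_double_half f).
have ef := odd_double_half f; move: ef; set m := f./2; set p := 16 ^ m.
case: (odd f) => /= <-; rewrite ?add1n ?add0n ?expnS four -/p ?uphalf_double ?doubleK.
  set c := 'C(m.*2.+1, m); set c' := 'C(m.*2, m) => h _.
  rewrite -(@leq_pmul2l 4) // [4 * (4 * p)]mulnA; apply: leq_trans h.
  rewrite (_ : 2 * c * (2 * c) = 4 * (c * c)); last lia.
  by rewrite -[leqRHS]mulnA !leq_mul2l doubleS ltnS (leq_trans _ (leqnSn _)) ?leqnSn ?orbT.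
set c := 'C(m.*2.+1, m); set c' := 'C(m.*2, m) => _ h.
by apply: leq_trans h; rewrite leq_mul2l leqnSn orbT.
Qed.

Section Resampling.
Variable I : finType.
Implicit Types (S K X Y : {set I}).

Definition flip X Y : {set I} := [set i | (i \in X) (+) (i \in Y)].

Lemma flipK Y : involutive (flip^~ Y).
Proof. by move=> X; apply/setP => i; rewrite !inE -addbA addbb addbF. Qed.

Definition flip_invariant S (A : eqType) (G : {set I} -> A) :=
  forall X Y, Y \subset S -> G (flip X Y) = G X.

(** Flipping the coins of any [Y] inside [S] permutes the samples and does not
    change [G], so [F] may be replaced by its average over these flips. *)
Lemma resample S (F G : {set I} -> nat) c :
  flip_invariant S G ->
  (forall X, \sum_(Y in powerset S) F (flip X Y) <= c * 2 ^ #|S|) ->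
  \sum_X F X * G X <= c * \sum_X G X.
Proof.
move=> invG avgF; rewrite -(leq_pmul2l (expn_gt0 2 #|S|)).
rewrite -{1}card_powerset -sum_nat_const.
rewrite (eq_bigr (fun Y => \sum_X F (flip X Y) * G X)); last first.
  move=> Y; rewrite inE => YS.
  rewrite (reindex_inj (inv_inj (flipK Y))) /=; apply: eq_bigr => X _.
  by rewrite invG.
rewrite exchange_big /= mulnA big_distrr /=.
by apply: leq_sum => X _; rewrite -big_distrl /= leq_mul2r [_ * c]mulnC avgF orbT.
Qed.

(** The coins of the last block affect no earlier factor.  They are averaged
    out first, and then those of the block before, and so on. *)
Lemma resample_prod (V : eqType) (r : seq V) (R : rel V) (S : V -> {set I})
    (F : V -> {set I} -> nat) c :
  pairwise R r ->
  (forall u v, R u v -> flip_invariant (S v) (F u)) ->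
  {in r, forall v X, \sum_(Y in powerset (S v)) F v (flip X Y) <= c * 2 ^ #|S v|} ->
  \sum_X \prod_(v <- r) F v X <= c ^ size r * 2 ^ #|I|.
Proof.
move=> + inv; elim/last_ind: r => [_ _|r v IHr].
  under eq_bigr do rewrite big_nil.
  by rewrite sum1_card mul1n -[#|I|]cardsT -card_powerset powersetT cardsT.
rewrite pairwise_rcons => /andP[/allP rv pr] avg.
have avgv : forall X, \sum_(Y in powerset (S v)) F v (flip X Y) <= c * 2 ^ #|S v|.
  by apply: avg; rewrite mem_rcons mem_head.
have invr : flip_invariant (S v) (fun X => \prod_(u <- r) F u X).
  by move=> X Y YS; apply: eq_big_seq => u ur; apply: inv (rv u ur) X Y YS.
under eq_bigr do rewrite big_rcons /= mulnC.
apply: leq_trans (resample invr avgv) _.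
rewrite size_rcons expnS -mulnA leq_mul2l; apply/orP; right; apply: IHr => // u ur.
by apply: avg; rewrite mem_rcons inE ur orbT.
Qed.

Lemma agreements_flip_inj S K X : {in powerset S &, injective (fun Y =>
  [set i in S | (i \in flip X Y) == (i \in K)])}.
Proof.
move=> Y Z; rewrite !inE => YS ZS /setP e; apply/setP => i; have := e i; rewrite !inE.
case: (boolP (i \in S)) => [_|iS] /=; last first.
  by rewrite (contraNF (subsetP YS i) iS) (contraNF (subsetP ZS i) iS).
by case: (i \in X); case: (i \in Y); case: (i \in Z); case: (i \in K).
Qed.

Lemma card_agreements_eq S K X j :
  #|[set Y in powerset S | agreements S K (flip X Y) == j]| <= 'C(#|S|, j).
Proof.
rewrite -cards_draws -(card_in_imset (f := fun Y =>
  [set i in S | (i \in flip X Y) == (i \in K)])).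
  apply/subset_leq_card/subsetP => _ /imsetP[Y + ->]; rewrite inE => /andP[_ hY].
  by rewrite inE hY andbT; apply/subsetP => i; rewrite inE => /andP[].
move=> Y Z; rewrite inE => /andP[YS _]; rewrite inE => /andP[ZS _]; exact: agreements_flip_inj.
Qed.

(** As [Y] runs through the subsets of [S], the set of agreements runs through
    the subsets of [S] too, and at most [W + 1] sizes fall in the window. *)
Lemma card_agreements_window S K X (a : int) W :
  #|[set Y in powerset S | absz (a + Posz (agreements S K (flip X Y)).*2)%R <= W]|
    <= W.+1 * 'C(#|S|, #|S|./2).
Proof.
set Z := [set Y in _ | _].
case: (set_0Vmem Z) => [->|[Y0 Y0Z]]; first by rewrite cards0.
have exP : exists j, absz (a + Posz j.*2)%R <= W.
  by move: Y0Z; rewrite inE => /andP[_ h]; exists (agreements S K (flip X Y0)).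
case: (ex_minnP exP) => j0 j0W j0min.
have sub : Z \subset \bigcup_(i in 'I_W.+1)
    [set Y in powerset S | agreements S K (flip X Y) == j0 + i].
  apply/subsetP => Y; rewrite inE => /andP[YS hY].
  have le0 := j0min _ hY.
  have ltW : agreements S K (flip X Y) - j0 < W.+1 by move: hY j0W; lia.
  apply/bigcupP; exists (Ordinal ltW) => //.
  by rewrite inE YS /= subnKC.
apply: leq_trans (subset_leq_card sub) _.
rewrite -[X in X * _]card_ord; apply: leq_card_bigcup => i _.
by apply: leq_trans (card_agreements_eq _ _ _ _) (leq_bin_half _ _).
Qed.

Lemma rare_window S K X (a : int) W B : (W.+1 * B) ^ 2 <= #|S| ->
  B * #|[set Y in powerset S | absz (a + Posz (agreements S K (flip X Y)).*2)%R <= W]|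
    <= 2 ^ #|S|.
Proof.
move=> WB; rewrite -leq_sqr (_ : (2 ^ #|S|) ^ 2 = 4 ^ #|S|); last by rewrite -expnM mulnC expnM.
apply: leq_trans (bin_bound #|S| #|S|./2).
have := card_agreements_window S K X a W; rewrite -leq_sqr.
set z := #|_|; set c := 'C(_, _) => zc.
rewrite expnMn; apply: (@leq_trans (B ^ 2 * (W.+1 * c) ^ 2)).
  by rewrite leq_mul2l zc orbT.
by rewrite -expnMn mulnA expnMn mulnC [B * _]mulnC leq_mul2l WB orbT.
Qed.
End Resampling.

(** * Random tournaments from cyclically oriented triples *)

Lemma sum_nat_of_bool (T : finType) (P b : pred T) :
  \sum_(u | P u) b u = #|[pred u | P u && b u]|.
Proof. by rewrite -sum1_card [RHS]big_mkcondr; apply: eq_bigr => u _; case: b. Qed.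

Section Tournament.
Local Open Scope ring_scope.
Variable T : finZmodType.
Implicit Types (u v w : T) (A : {set T}) (X Y : {set {set T}}).

Definition position u : nat := enum_rank u.

Lemma position_eq u v : (position u == position v) = (u == v).
Proof. by apply/eqP/eqP => [/ord_inj/enum_rank_inj|->]. Qed.

(** The orientation [u -> v -> w -> u] is the one in which the positions of
    [u, v, w] increase, up to rotation. *)
Definition cyc u v w : bool :=
  [|| (position u < position v < position w)%N, (position v < position w < position u)%N
    | (position w < position u < position v)%N].

Lemma cyc_swap u v w : u != v -> v != w -> w != u -> cyc v u w = ~~ cyc u v w.
Proof. rewrite /cyc -!position_eq; lia. Qed.

Lemma cyc_rot u v w : cyc u v w = cyc v w u.
Proof. rewrite /cyc; lia. Qed.

Definition third u v : T := - (u + v).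

Lemma thirdC u v : third u v = third v u.
Proof. by rewrite /third addrC. Qed.

Lemma thirdK v : involutive (third v).
Proof. by move=> u; rewrite /third opprD opprK addKr. Qed.

Definition triple u v : {set T} := [set u; v; third u v].

Lemma tripleC u v : triple u v = triple v u.
Proof. by rewrite /triple thirdC [[set u; v]]setUC. Qed.

Lemma triple_third u v : triple u (third u v) = triple u v.
Proof. by rewrite /triple thirdK -!setUA [[set _] :|: [set v]]setUC. Qed.

(** The middle condition and the first alternative treat the pairs
    [{a, -2a}], whose third element is [a]: the arc goes from [a] to [-2a]. *)
Definition tri_arc X u v : bool := [&& v != u, third u v != v &
  (third u v == u) || (cyc u v (third u v) (+) (triple u v \in X))].

Lemma tri_arc_irr X : irreflexive (tri_arc X).
Proof. by move=> u; rewrite /tri_arc eqxx. Qed.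

Lemma tri_arc_asym X u v : u != v -> tri_arc X v u = ~~ tri_arc X u v.
Proof.
move=> uv; rewrite /tri_arc [v == u]eq_sym uv thirdC tripleC /=; set w := third u v.
case: (eqVneq w u) => [->|wu]; first by rewrite uv.
case: (eqVneq w v) => [->|wv]; first by [].
by rewrite /= cyc_swap // 1?eq_sym // addNb.
Qed.

(** In a triple, each vertex has one arc in and one arc out.  The identity
    extends to [v = u] and [v = -2u], where one of the two terms is the arc
    from [u] to itself. *)
Lemma tri_arc_third X u v : (tri_arc X u v + tri_arc X u (third u v) = (third u v != v))%N.
Proof.
rewrite /tri_arc thirdK triple_third; set w := third u v.
case: (eqVneq w v) => [->|wv]; first by rewrite !andbF.
case: (eqVneq v u) => [<-|vu]; first by rewrite wv.
case: (eqVneq w u) => [->|wu] //=.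
have -> : cyc u w v = ~~ cyc u v w by rewrite -cyc_rot cyc_swap // eq_sym.
by rewrite addNb; case: (_ (+) _).
Qed.

(** Pairing [u] with [third v u], each pair contains one out-neighbour of [v],
    except for the at most one [u] with [u = third v u]. *)
Lemma out_tri_arc X v : injective (fun u : T => u + u) ->
  (#|T|.-1 <= #|[set u | tri_arc X v u]|.*2)%N.
Proof.
move=> inj2; have -> : #|[set u | tri_arc X v u]| = (\sum_u tri_arc X v u)%N.
  by rewrite sum_nat_of_bool; apply: eq_card => u; rewrite inE.
rewrite -addnn.
rewrite [in X in (_ <= _ + X)%N](reindex_inj (inv_inj (@thirdK v))) /= -big_split /=.
rewrite (eq_bigr (fun u => nat_of_bool (third v u != u))); last first.
  by move=> u _; rewrite tri_arc_third.
have : (#|[pred u | third v u == u]| <= 1)%N.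
  apply/card_le1_eqP => x y; rewrite !inE => /eqP ex /eqP ey; apply: inj2.
  by rewrite -{1}ex -{1}ey /third; rewrite !opprD !addrNK.
have -> : (\sum_u (third v u != u))%N = #|[pred u | third v u != u]|.
  by rewrite sum_nat_of_bool.
rewrite -[X in (X.-1 <= _)%N](cardC [pred u | third v u == u]).
by set a := #|_|; set b := #|_|; lia.
Qed.

Section Deviation.
Variable A : {set T}.

Definition open_nbrs v : {set T} := [set u in A | (u != v) && (third v u \notin A)].

Definition coin_sign (b : bool) : int := if b then 1 else -1.

Definition imbalance X v : int := \sum_(u in open_nbrs v) coin_sign (tri_arc X v u).

Lemma open_nbrs_sym u v : u \in A -> v \in A -> (u \in open_nbrs v) = (v \in open_nbrs u).
Proof. by move=> uA vA; rewrite !inE uA vA eq_sym thirdC. Qed.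

Lemma sum_imbalance X : \sum_(v in A) imbalance X v = 0.
Proof.
have : \sum_(v in A) imbalance X v = - \sum_(v in A) imbalance X v.
  rewrite [LHS](exchange_big_dep (mem A)) /=; last by move=> v u _; rewrite inE => /andP[].
  rewrite -sumrN; apply: eq_bigr => u uA; rewrite /imbalance -sumrN.
  apply: eq_big => v.
    by case: (boolP (v \in A)) => vA; [rewrite open_nbrs_sym | rewrite [in RHS]inE (negPf vA)].
  by rewrite inE => /andP[vA /and3P[_ uv _]]; rewrite (tri_arc_asym X uv) /coin_sign; case: tri_arc.
lia.
Qed.

(** Triples inside [A] contain one out-neighbour of [v] for two elements of
    [A], so that the excess over one half of [A] comes from the open ones. *)
Lemma out_le_imbalance X v : (#|[set u in A | tri_arc X v u]|.*2)%:Z <= #|A|%:Z + imbalance X v.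
Proof.
rewrite -(cardsID [set u | third v u \in A] [set u in A | _]).
set out1 := #|_|; set out2 := #|_|.
have le1 : (out1.*2 <= #|[set u in A | third v u \in A]|)%N.
  have -> : out1 = (\sum_(u in [set u in A | third v u \in A]) tri_arc X v u)%N.
    rewrite sum_nat_of_bool; apply: eq_card => u; rewrite !inE; apply: andbAC.
  rewrite -addnn [in X in (_ + X <= _)%N](reindex_inj (inv_inj (@thirdK v))) /=.
  rewrite [in X in (_ + X <= _)%N](eq_bigl (mem [set u in A | third v u \in A])); last first.
    by move=> u; rewrite !inE thirdK andbC.
  rewrite -big_split /= -sum1_card; apply: leq_sum => u _.
  by rewrite tri_arc_third; case: eqP.
have eq2 : out2 = (\sum_(u in open_nbrs v) tri_arc X v u)%N.
  rewrite sum_nat_of_bool; apply: eq_card => u; rewrite !inE.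
  case: (u \in A); rewrite ?andbF //=; case: (eqVneq u v) => [->|_].
    by rewrite tri_arc_irr andbF.
  by [].
have devE : (out2.*2)%:Z = #|open_nbrs v|%:Z + imbalance X v.
  rewrite eq2 /imbalance -sum1_card -muln2 big_distrl /= !(big_morph _ PoszD (erefl _)).
  rewrite -big_split /=.
  by apply: eq_bigr => u _; case: tri_arc.
have cA : (#|[set u in A | third v u \in A]| + #|open_nbrs v| <= #|A|)%N.
  rewrite -(cardsID [set u | third v u \in A] A); apply: leq_add; apply: subset_leq_card.
    by apply/subsetP => u; rewrite !inE.
  by apply/subsetP => u; rewrite !inE => /and3P[-> _ ->].
lia.
Qed.

End Deviation.
End Tournament.

(** * Nearly balanced subsets are rare *)

Section Counting.
Local Open Scope ring_scope.
Variables (T : finZmodType) (A : {set T}).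
Implicit Types (u v w : T) (X Y : {set {set T}}).
Local Notation open_nbrs := (open_nbrs A).
Local Notation imbalance := (imbalance A).

(** The coins are revealed vertex by vertex in the order of [position]: the
    coin of a triple is attributed to the first of its two vertices in [A]. *)
Definition later_nbrs v : {set T} := [set u in open_nbrs v | (position v < position u)%N].
Definition later_triples v : {set {set T}} := triple v @: later_nbrs v.

Lemma open_nbrsP u v : u \in open_nbrs v -> [/\ u \in A, u != v & third v u \notin A].
Proof. by rewrite inE => /and3P[]. Qed.

Lemma triple_mem v u w : w \in A -> u \in open_nbrs v ->
  w \in triple v u -> w = v \/ w = u.
Proof.
move=> wA /open_nbrsP[_ _ tA]; rewrite !inE => /orP[/orP[]/eqP->|/eqP e].
- by left.
- by right.
- by rewrite e (negPf tA) in wA.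
Qed.

(** An open triple meets [A] in its two defining vertices only, so it
    determines them. *)
Lemma triple_inj v : v \in A -> {in open_nbrs v &, injective (triple v)}.
Proof.
move=> vA u w uf wf e; have [uA uv _] := open_nbrsP uf.
have : u \in triple v w by rewrite -e !inE eqxx orbT.
by case/(triple_mem uA wf) => // uv'; rewrite uv' eqxx in uv.
Qed.

Lemma later_open v : later_nbrs v \subset open_nbrs v.
Proof. by apply/subsetP => u; rewrite inE => /andP[]. Qed.

Lemma card_later_triples v : v \in A -> #|later_triples v| = #|later_nbrs v|.
Proof.
move=> vA; apply: card_in_imset => x y /(subsetP (later_open v)) xf.
by move/(subsetP (later_open v)); apply: triple_inj.
Qed.

Lemma tri_arc_flip X Y v u : triple v u \notin Y -> tri_arc (flip X Y) v u = tri_arc X v u.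
Proof. by move=> nY; rewrite /tri_arc !inE (negPf nY) addbF. Qed.

Lemma imbalance_flip_invariant u v : u \in A -> (position u < position v)%N ->
  flip_invariant (later_triples v) (fun X => imbalance X u).
Proof.
move=> uA uv X Y YS; apply: eq_bigr => w wf; rewrite tri_arc_flip //.
apply: contraL uv => /(subsetP YS)/imsetP[z]; rewrite inE => /andP[zf vz] e.
have : u \in triple v z by rewrite -e !inE eqxx.
by case/(triple_mem uA zf) => ->; lia.
Qed.

Lemma imbalance_flip v : v \in A -> exists K, forall X, exists a, forall Y,
  Y \subset later_triples v ->
  imbalance (flip X Y) v = a + Posz (agreements (later_triples v) K (flip X Y)).*2.
Proof.
(* For these triples, the coin value [true] directs the arc away from [v]. *)
move=> vA; exists (triple v @: [set u in later_nbrs v | ~~ cyc v u (third v u)]) => X.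
pose before_v u := ~~ (position v < position u)%N.
exists (\sum_(u in open_nbrs v | before_v u) coin_sign (tri_arc X v u) - Posz #|later_nbrs v|).
move=> Y YS.
have agreementsE : agreements (later_triples v)
    (triple v @: [set u in later_nbrs v | ~~ cyc v u (third v u)]) (flip X Y) =
    (\sum_(u in later_nbrs v) tri_arc (flip X Y) v u)%N.
  rewrite sum_nat_of_bool /agreements -[RHS]cardsE.
  rewrite -[RHS](card_in_imset (f := triple v)); last first.
    move=> x y; rewrite !inE -!andbA => /and5P[x1 x2 x3 _ _] /and5P[y1 y2 y3 _ _].
    by apply: triple_inj => //; rewrite inE ?x1 ?x2 ?y1 ?y2.
  have key u : u \in later_nbrs v -> tri_arc (flip X Y) v u = ((triple v u \in flip X Y) ==
      (triple v u \in triple v @: [set u in later_nbrs v | ~~ cyc v u (third v u)])).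
    move=> ul; have uf := subsetP (later_open v) _ ul.
    have [uA uv tA] := open_nbrsP uf.
    have -> : (triple v u \in triple v @: [set u in later_nbrs v | ~~ cyc v u (third v u)]) =
        ~~ cyc v u (third v u).
      apply/imsetP/idP => [[z]|nc]; last by exists u => //; rewrite inE ul.
      rewrite inE => /andP[zl cz] /(triple_inj vA uf (subsetP (later_open v) _ zl)) ->.
      exact: cz.
    rewrite /tri_arc uv /=; case: (eqVneq (third v u) u) => [e|_] /=; first by rewrite e uA in tA.
    case: (eqVneq (third v u) v) => [e|_] /=; first by rewrite e vA in tA.
    by case: cyc; case: (_ \in _).
  apply: eq_card => t; rewrite inE; apply/andP/imsetP.
    case=> /imsetP[u ul ->] h; exists u => //.
    have : (u \in later_nbrs v) && tri_arc (flip X Y) v u by rewrite ul key.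
    by rewrite !inE.
  case=> u hu ->; have /andP[ul tu] : (u \in later_nbrs v) && tri_arc (flip X Y) v u.
    by move: hu; rewrite !inE.
  by rewrite -key // imset_f.
rewrite agreementsE /imbalance (bigID (fun u => (position v < position u)%N)) /= addrC -addrA.
congr (_ + _).
  apply: eq_bigr => u /andP[uf nlt]; rewrite tri_arc_flip //.
  apply: contra nlt => /(subsetP YS)/imsetP[z zl e].
  have zf := subsetP (later_open v) _ zl.
  by move: zl; rewrite (triple_inj vA uf zf e) inE => /andP[].
rewrite -sum1_card -muln2 big_distrl /= !(big_morph _ PoszD (erefl _)) -sumrN -big_split /=.
rewrite [RHS](eq_bigl (fun u => (u \in open_nbrs v) && (position v < position u)%N)); last first.
  by move=> u; rewrite inE.
by apply: eq_bigr => u _; case: tri_arc.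
Qed.

(** The weight [b ^ 2] rewards a small imbalance so much that its average is
    still [O(1)] when [b ^ 2] is the inverse of the probability of a small
    imbalance; the product of the weights then detects samples in which half
    of the vertices have small imbalance, by Markov. *)
Definition small_weight (W b : nat) v X : nat :=
  if (absz (imbalance X v) <= W)%N then (b ^ 2)%N else 1%N.

Lemma small_weight_avg W b v X : v \in A -> ((W.+1 * b ^ 2) ^ 2 <= #|later_nbrs v|)%N ->
  (\sum_(Y in powerset (later_triples v)) small_weight W b v (flip X Y)
    <= 2 * 2 ^ #|later_triples v|)%N.
Proof.
move=> vA large; have [K /(_ X)[a aP]] := imbalance_flip vA.
rewrite -card_later_triples // in large.
have := rare_window K X a large; set Z := [set Y in _ | _] => rareZ.
apply: (@leq_trans (\sum_(Y in powerset (later_triples v)) (1 + (Y \in Z) * b ^ 2))%N).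
  apply: leq_sum => Y YS; rewrite /small_weight inE YS -aP; last by rewrite -powersetE.
  by case: ifP => _ //=; rewrite mul1n leq_addl.
rewrite big_split /= sum1_card card_powerset mul2n -addnn leq_add2l -big_distrl /=.
rewrite sum_nat_of_bool mulnC; apply: leq_trans rareZ; rewrite leq_mul2l; apply/orP; right.
by apply/subset_leq_card/subsetP => Y; rewrite inE => /andP[].
Qed.

Definition balanced_at_least (w : nat) : {set {set {set T}}} :=
  [set X | [forall v in A, - (Posz w) <= imbalance X v]].

(** Since the imbalances sum to 0, a lower bound [- w] on all of them bounds
    the sum of their absolute values by [2 * n * w], so that at most half of
    the vertices of [P] have imbalance above [4 * a * w].  The sample then has
    weight at least [b ^ #|P|], against an average of at most [2 ^ #|P|].  The
    value of [b] makes the quotient [2 ^ (3 * a * #|P|)]. *)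
Lemma few_balanced (n a w : nat) (P : {set T}) :
  #|A| = n -> P \subset A -> (n <= a * #|P|)%N -> (0 < a)%N ->
  (forall v, v \in P -> (((4 * a * w).+1 * (2 ^ (3 * a).+1) ^ 2) ^ 2 <= #|later_nbrs v|)%N) ->
  (#|balanced_at_least w| * 2 ^ (3 * n) <= 2 ^ #|{: {set T}}|)%N.
Proof.
move=> cA PA nP a0 large; set W := (4 * a * w)%N; set b := (2 ^ (3 * a).+1)%N.
pose F := small_weight W b.
pose le_position : rel T := fun u v => (position u <= position v)%N.
pose r := sort le_position (enum P).
have r_uniq : uniq r by rewrite sort_uniq enum_uniq.
have memr v : (v \in r) = (v \in P) by rewrite mem_sort mem_enum.
have sz : size r = #|P| by rewrite size_sort -cardE.
pose before : rel T := fun u v => (u \in A) && (position u < position v)%N.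
have r_before : pairwise before r.
  have p1 : pairwise le_position r.
    rewrite -sorted_pairwise; last by move=> u v w'; exact: leq_trans.
    by apply: sort_sorted => u v; exact: leq_total.
  have p2 : pairwise (fun u v => u != v) r by rewrite -uniq_pairwise.
  have : pairwise [rel u v | le_position u v && (u != v)] r by rewrite pairwise_relI p1.
  apply: (@sub_in_pairwise _ (mem P)); last by apply/allP => v; rewrite memr.
  move=> u v uP vP /= /andP[]; rewrite /le_position /before (subsetP PA _ uP) -position_eq; lia.
have prodF := @resample_prod _ _ r before later_triples F 2 r_before.
have {prodF} total : (\sum_X \prod_(v <- r) F v X <= 2 ^ #|P| * 2 ^ #|{: {set T}}|)%N.
  rewrite -sz; apply: prodF => [u v /andP[uA uv] X Y YS|v].
    by rewrite /F /small_weight (imbalance_flip_invariant uA uv).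
  rewrite memr => vP X; apply: small_weight_avg; first exact: (subsetP PA).
  exact: large.
have low X : X \in balanced_at_least w -> (b ^ #|P| <= \prod_(v <- r) F v X)%N.
  rewrite inE => /forall_inP devX.
  have sumabs : (\sum_(v in A) absz (imbalance X v) <= 2 * n * w)%N.
    have : \sum_(v in A) (absz (imbalance X v))%:Z <= \sum_(v in A) (imbalance X v + (2 * w)%:Z).
      by apply: ler_sum => v /devX; lia.
    rewrite big_split /= sum_imbalance add0r sumr_const cA -(big_morph _ PoszD (erefl _)).
    by rewrite -mulr_natr; lia.
  pose bad := [set v in P | (W < absz (imbalance X v))%N].
  have badW : (#|bad| * W.+1 <= 2 * n * w)%N.
    apply: leq_trans sumabs; rewrite -sum_nat_const.
    rewrite [leqRHS](bigID (mem bad)) /= ; apply: leq_trans (leq_addr _ _).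
    rewrite [leqRHS](eq_bigl (mem bad)); last first.
      move=> v /=; case: (boolP (v \in bad)) => vb; rewrite ?andbF ?andbT //.
      by apply: (subsetP PA); move: vb; rewrite inE => /andP[].
    by apply: leq_sum => v; rewrite inE => /andP[].
  have bad2 : (2 * #|bad| <= #|P|)%N.
    have [w0|w0] := posnP w; first by move: badW; rewrite w0 !muln0; lia.
    rewrite -(leq_pmul2l a0); apply: leq_trans nP; rewrite -(leq_pmul2l w0).
    by move: badW; rewrite /W; set z := #|bad|; nia.
  have -> : (\prod_(v <- r) F v X = (b ^ 2) ^ #|P :\: bad|)%N.
    rewrite (perm_big (enum P)) /=; last by rewrite perm_sort.
    rewrite big_enum /= (bigID (mem bad)) /= big1 ?mul1n; last first.
      by move=> v /andP[_]; rewrite inE /F /small_weight => /andP[_]; case: leqP.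
    rewrite -prod_nat_const; apply: eq_big => v; first by rewrite in_setD andbC.
    by move=> /andP[vP]; rewrite inE vP /= -leqNgt /F /small_weight => ->.
  rewrite -expnM leq_pexp2l ?expn_gt0 //.
  have := cardsID bad P; rewrite (setIidPr _); first lia.
  by apply/subsetP => v; rewrite inE => /andP[].
have : (#|balanced_at_least w| * b ^ #|P| <= 2 ^ #|P| * 2 ^ #|{: {set T}}|)%N.
  apply: leq_trans total; rewrite -sum_nat_const [leqRHS](bigID (mem (balanced_at_least w))) /=.
  by apply: leq_trans (leq_addr _ _); apply: leq_sum.
rewrite /b expnS expnMn mulnCA leq_pmul2l ?expn_gt0 // -expnM.
apply: leq_trans; rewrite leq_mul2l leq_pexp2l ?orbT // -mulnA leq_mul2l.
by rewrite nP.
Qed.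
End Counting.

(** * Subsets of half size have many open pairs *)

Section Additive.
Local Open Scope ring_scope.
Variable T : finZmodType.

Definition dbl (u : T) : T := u + u.

Variables (A : {set T}) (n : nat).
Hypotheses (cA : #|A| = n) (cT : #|T| = n.*2.+1) (inj2 : injective dbl).
Implicit Types (u v x h : T).

Definition exits h : {set T} := [set x in A | x + h \notin A].
Definition stays h : {set T} := [set x in A | x + h \in A].
Definition open_at v : {set T} := [set u in A | third v u \notin A].

Lemma card_exits_stays h : (#|stays h| + #|exits h|)%N = n.
Proof.
rewrite -cA -(cardsID [set x | x + h \in A] A); congr (_ + _)%N; apply: eq_card => x.
  by rewrite !inE.
by rewrite !inE andbC.
Qed.

Lemma card_shift (B : {set T}) h : #|[set x | x + h \in B]| = #|B|.
Proof.
by rewrite -(card_preimset B (GRing.addIr h)); apply: eq_card => x; rewrite !inE.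
Qed.

Lemma exits_double h : (#|exits (dbl h)| <= 2 * #|exits h|)%N.
Proof.
have sub : exits (dbl h) \subset exits h :|: [set x | x + h \in exits h].
  apply/subsetP => x; rewrite !inE /dbl addrA => /andP[-> ->]; by case: (_ \in A).
apply: leq_trans (subset_leq_card sub) _.
apply: leq_trans (leq_of_leqif (leq_card_setU _ _)) _.
by rewrite card_shift mul2n addnn.
Qed.

(** If [x] is in [A] and [x + 2h] is not, then either [x + h] is in [A], or
    both [x + h] and [x + 2h] avoid [A].  As the complement of [A] has one
    element more than [A], the second case is as frequent as staying in [A],
    up to 1. *)
Lemma exits_double_stays h : (#|exits (dbl h)| <= (2 * #|stays h|).+1)%N.
Proof.
pose outs := [set x | (x \notin A) && (x + h \notin A)].
have sub : exits (dbl h) \subset stays h :|: [set x | x + h \in outs].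
  apply/subsetP => x; rewrite !inE /dbl addrA => /andP[-> ->]; by case: (_ \in A).
apply: leq_trans (subset_leq_card sub) _.
apply: leq_trans (leq_of_leqif (leq_card_setU _ _)) _.
rewrite card_shift.
have e1 : (#|[set x | (x + h)%R \in A]| = #|stays h| + #|[set x | (x + h)%R \in A] :\: A|)%N.
  rewrite -(cardsID A [set x | x + h \in A]); congr (_ + _)%N; apply: eq_card => x.
  by rewrite !inE andbC.
have e2 : (#|~: A| = #|[set x | (x + h)%R \in A] :\: A| + #|outs|)%N.
  rewrite -(cardsID [set x | x + h \in A] (~: A)); congr (_ + _)%N; apply: eq_card => x.
    by rewrite !inE andbC.
  by rewrite !inE andbC.
have := cardsC A; rewrite card_shift cA in e1; rewrite cA cT; lia.
Qed.

Lemma sum_exits : (\sum_h #|exits h| = n * n.+1)%N.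
Proof.
transitivity (\sum_h \sum_(x in A) ((x + h)%R \notin A))%N.
  by apply: eq_bigr => h _; rewrite sum_nat_of_bool; apply: eq_card => x; rewrite !inE.
rewrite exchange_big /= -cA -sum_nat_const; apply: eq_bigr => x _.
rewrite sum_nat_of_bool (_ : #|_| = #|[set h | h + x \in ~: A]|); last first.
  by apply: eq_card => h; rewrite !inE addrC.
by rewrite card_shift; have := cardsC A; rewrite cA cT; lia.
Qed.

(** Both translates [A + a] and [A + a0] lie in [- A], except for as many
    elements as there are open pairs at [a] and [a0] respectively. *)
Lemma exits_sub a a0 : (#|exits (a - a0)%R| <= #|open_at a| + #|open_at a0|)%N.
Proof.
pose B : {set T} := [set y : T | - y \in A].
have cB : #|B| = n.
  by rewrite -cA -(card_preimset A oppr_inj); apply: eq_card => x; rewrite !inE.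
pose C : {set T} := [set x : T | x + a \in [set z : T in B | z - a0 \notin A]].
have sub : exits (a - a0)%R \subset open_at a :|: C.
  apply/subsetP => x; rewrite !inE /third addrA [a + x]addrC => /andP[-> ->].
  by case: (_ \in A).
apply: leq_trans (subset_leq_card sub) _.
apply: leq_trans (leq_of_leqif (leq_card_setU _ _)) _; rewrite leq_add2l card_shift.
have e1 := cardsID [set z : T | z - a0 \in A] B.
have e2 := cardsID [set u : T | third a0 u \in A] A.
have : #|B :&: [set z : T | z - a0 \in A]| = #|A :&: [set u : T | third a0 u \in A]|.
  rewrite -[RHS](card_shift _ (- a0)); apply: eq_card => z.
  by rewrite !inE /third andbC [a0 + _]addrC subrK.
have -> : [set z : T in B | z - a0 \notin A] = B :\: [set z : T | z - a0 \in A].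
  by apply/setP => z; rewrite !inE andbC.
have -> : open_at a0 = A :\: [set u : T | third a0 u \in A].
  by apply/setP => z; rewrite !inE andbC.
rewrite cB in e1; rewrite cA in e2; lia.
Qed.

(** Suppose few pairs are open.  Then [A] is nearly invariant under the [n]
    differences [a - a0], by [exits_sub].  The exits sum to [n * (n + 1)], so
    that the [n + 1] other translations move nearly all of [A] out.  In both
    cases the double of the translation nearly preserves [A].  But the doubles
    are all the elements of the group, which contradicts the sum of the
    exits. *)
Lemma many_open : (n ^ 2 <= 8 * (\sum_(v in A) #|open_at v|) + 1)%N.
Proof.
set E := (\sum_(v in A) _)%N.
have one a0 : a0 \in A -> (n * n <= 4 * (E + n * #|open_at a0|) + 1)%N.
  move=> a0A; pose D := [set a - a0 | a in A].
  have cD : #|D| = n by rewrite card_imset //; exact: GRing.addIr.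
  pose F (h : T) := #|exits h|.
  have FD : (\sum_(h in D) F h <= E + n * #|open_at a0|)%N.
    rewrite big_imset /=; last by move=> x y _ _; exact: GRing.addIr.
    rewrite -{1}cA -sum_nat_const -big_split /=.
    by apply: leq_sum => a _; exact: exits_sub.
  have split : (\sum_(h in D) F h + \sum_(h in ~: D) F h = n * n.+1)%N.
    rewrite -sum_exits [RHS](bigID (mem D)) /=; congr (_ + _)%N.
    by apply: eq_bigl => h; rewrite inE.
  have cDC : #|~: D| = n.+1 by have := cardsC D; rewrite cD cT; lia.
  have co : (\sum_(h in ~: D) F (dbl h) + 2 * \sum_(h in ~: D) F h <= n.+1 * (2 * n + 1))%N.
    rewrite -cDC big_distrr /= -big_split /= -sum_nat_const; apply: leq_sum => h _.
    have := exits_double_stays h; have := card_exits_stays h; rewrite /F; lia.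
  have dir : (\sum_(h in D) F (dbl h) <= 2 * \sum_(h in D) F h)%N.
    by rewrite big_distrr /=; apply: leq_sum => h _; exact: exits_double.
  have tot : (\sum_(h in D) F (dbl h) + \sum_(h in ~: D) F (dbl h) = n * n.+1)%N.
    rewrite -sum_exits [RHS](reindex_inj inj2) /= [RHS](bigID (mem D)) /=; congr (_ + _)%N.
    by apply: eq_bigl => h; rewrite inE.
  lia.
have [n0|n0] := posnP n; first by rewrite n0.
have : (\sum_(a0 in A) n * n <= \sum_(a0 in A) (4 * (E + n * #|open_at a0|) + 1))%N.
  by apply: leq_sum.
rewrite sum_nat_const big_split /= -big_distrr /= big_split /= -big_distrr /= !sum_nat_const.
rewrite -/E cA => h; rewrite -(leq_pmul2l n0); lia.
Qed.

(** Being open is symmetric, and every open pair of distinct vertices is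
    counted at the earlier one; the diagonal accounts for at most [n] pairs. *)
Lemma many_later_nbrs : (17 <= n)%N -> (n ^ 2 <= 32 * \sum_(v in A) #|later_nbrs A v|)%N.
Proof.
move=> n17.
have fr v : (#|open_at v| <= (#|open_nbrs A v|).+1)%N.
  have sub : open_at v \subset v |: open_nbrs A v.
    by apply/subsetP => u; rewrite !inE => /andP[-> ->]; case: eqP.
  apply: leq_trans (subset_leq_card sub) _; rewrite cardsU1; lia.
have s1 : (\sum_(v in A) #|open_at v| <= \sum_(v in A) #|open_nbrs A v| + n)%N.
  rewrite -cA -sum1_card -big_split /=; apply: leq_sum => v _; rewrite addn1; exact: fr.
have s2 : (\sum_(v in A) #|open_nbrs A v| = 2 * \sum_(v in A) #|later_nbrs A v|)%N.
  have lE v : #|later_nbrs A v| = (\sum_(u in open_nbrs A v) (position v < position u))%N.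
    by rewrite sum_nat_of_bool -cardsE; apply: eq_card => u; rewrite !inE.
  have gE v : #|open_nbrs A v| =
      (\sum_(u in open_nbrs A v) (position v < position u) +
       \sum_(u in open_nbrs A v) (position u < position v))%N.
    rewrite -big_split /= -sum1_card; apply: eq_bigr => u /open_nbrsP[_ uv _].
    by move: uv; rewrite -position_eq; case: ltngtP.
  rewrite (eq_bigr _ (fun v _ => gE v)) big_split /= mul2n -addnn; congr (_ + _)%N.
    by apply: eq_bigr => v _; rewrite lE.
  rewrite (exchange_big_dep (mem A)) /=; last by move=> v u _ /open_nbrsP[].
  apply: eq_bigr => u uA; rewrite lE; apply: eq_bigl => v.
  by case: (boolP (v \in A)) => vA; [rewrite open_nbrs_sym | rewrite [in RHS]inE (negPf vA)].
have := many_open; nia.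
Qed.

Lemma many_vertices_with_later_nbrs : (17 <= n)%N ->
  (n <= 64 * #|[set v in A | n <= 64 * #|later_nbrs A v|]|)%N.
Proof.
move=> n17; set P := [set v in A | _].
have : (64 * \sum_(v in A) #|later_nbrs A v| <= \sum_(v in A) (n + (v \in P) * (64 * n)))%N.
  rewrite big_distrr /=; apply: leq_sum => v vA; rewrite inE vA /=.
  have le : (#|later_nbrs A v| <= n)%N.
    rewrite -cA subset_leq_card //; apply/subsetP => u; rewrite !inE.
    by case/andP=> /andP[].
  case: (leqP n (64 * #|later_nbrs A v|)) => h; rewrite ?mul1n ?mul0n.
    by apply: leq_trans (leq_addl _ _); rewrite leq_mul2l le orbT.
  by rewrite addn0 ltnW.
rewrite big_split /= sum_nat_const -big_distrl /= sum_nat_of_bool cA.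
have -> : #|[pred v | (v \in A) && (v \in P)]| = #|P|.
  by apply: eq_card => v; rewrite !inE andbA andbb.
move: (many_later_nbrs n17).
set S := (\sum_(v in A) _)%N => ml sumS.
have {}ml : (n ^ 2 <= 32 * S)%N by exact: ml.
have n_gt0 : (0 < n)%N by lia.
rewrite -(leq_pmul2l n_gt0); move: sumS ml; rewrite expnS expn1.
move: S #|P| => S p; nia.
Qed.
End Additive.

(** * The asymptotic upper bound on d(s) *)

Section Digraph.
Variable (s : nat).
Local Notation n := s.+1.
Local Notation T := 'I_(n.*2.+1).
Variable X : {set {set T}}.

Definition punctured_arc : rel T := fun u v => [&& tri_arc X u v, u != ord0 & v != ord0].

Lemma punctured_arc_verts u v : punctured_arc u v -> (u \in [set~ ord0]) && (v \in [set~ ord0]).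
Proof. by rewrite !inE => /and3P[_ -> ->]. Qed.

Lemma punctured_arc_irr : irreflexive punctured_arc.
Proof. by move=> u; rewrite /punctured_arc tri_arc_irr. Qed.

Definition punctured_tournament := Digraph punctured_arc_verts punctured_arc_irr.

Lemma dbl_inj : injective (@dbl T).
Proof.
move=> u v /(congr1 val) /=; case: u v => u ltu [v ltv] /= e; apply: val_inj => /=.
have red m : (m < n.*2.+1)%N -> ((m + m) %% n.*2.+1 =
    if m + m < n.*2.+1 then m + m else m + m - n.*2.+1)%N.
  move=> ltm; case: ltnP => le; first by rewrite modn_small.
  by rewrite -{1}(subnK le) modnDr modn_small //; lia.
by move: e; rewrite !red //; case: ifP; case: ifP; lia.
Qed.

Lemma punctured_min_outdeg : (s <= min_outdeg punctured_tournament)%N.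
Proof.
have V : (#|verts punctured_tournament| = n.*2)%N by rewrite cardsC1 card_ord.
rewrite leq_min_outdeg ?V //; apply/forall_inP => u; rewrite !inE => u0.
have large : (n <= #|[set v | tri_arc X u v]|)%N.
  by rewrite -leq_double; have := out_tri_arc X u dbl_inj; rewrite card_ord.
have sub : [set v | tri_arc X u v] \subset ord0 |: out_nbrs punctured_tournament u.
  by apply/subsetP => v; rewrite !inE /= /punctured_arc u0 => ->; case: eqP.
have := leq_trans large (subset_leq_card sub); rewrite cardsU1.
by case: (_ \notin _); rewrite ?add0n ?add1n // => /ltnW.
Qed.
End Digraph.

(** A union bound over the at most [2 ^ (2n + 1)] sets of [n] vertices: if [w]
    were so small that [few_balanced] applies to all of them, some outcome of
    the coins would leave none of them balanced. *)
Lemma halving_gap (a s d : nat) : a = 64 -> (17 <= s)%N -> halving s d ->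
  (s.+1 < (8 * ((4 * a * (s.+1 - d.*2)).+1 * (2 ^ (3 * a).+1) ^ 2)) ^ 2)%N.
Proof.
move=> ea s17 hsd; rewrite ltnNge; apply/negP => small.
set n := s.+1 in small *; set w := (n - d.*2)%N in small *.
pose T := 'I_(n.*2.+1).
have cT : #|T| = n.*2.+1 by rewrite card_ord.
pose bal (A : {set T}) := balanced_at_least A w.
have few (A : {set T}) : #|A| = n -> (#|bal A| * 2 ^ (3 * n) <= 2 ^ #|{: {set T}}|)%N.
  move=> cA; apply: (@few_balanced T A n a w [set v in A | (n <= 64 * #|later_nbrs A v|)%N]) => //.
  - by apply/subsetP => v; rewrite inE => /andP[].
  - by rewrite ea; apply: many_vertices_with_later_nbrs => //; [exact: dbl_inj | lia].
  - by rewrite ea.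
  move=> v; rewrite inE => /andP[_ nv]; rewrite -(@leq_pmul2l 64) //.
  apply: leq_trans nv; apply: leq_trans small; rewrite [leqRHS]expnMn.
  by rewrite leq_mul2r; apply/orP; right.
have cover : [set: {set {set T}}] \subset \bigcup_(A in [set A : {set T} | #|A| == n]) bal A.
  apply/subsetP => X _; pose G := punctured_tournament X.
  have cG : #|verts G| = n.*2 by rewrite cardsC1 card_ord.
  have [H [[HV Harc] cH dH]] := hsd n isT _ G cG (punctured_min_outdeg X).
  apply/bigcupP; exists (verts H); first by rewrite inE cH.
  rewrite inE; apply/forall_inP => v vH.
  have out := out_le_imbalance (verts H) X v; rewrite cH in out.
  have large : (d <= #|[set u in verts H | tri_arc X v u]|)%N.
    move: dH; rewrite leq_min_outdeg ?cH // => /forall_inP/(_ v vH) dv.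
    apply: leq_trans dv (subset_leq_card _); apply/subsetP => u; rewrite !inE => uv.
    by have /andP[_ ->] := arc_verts uv; have /and3P[] := Harc _ _ uv.
  have : (Posz d.*2 <= Posz n + imbalance (verts H) X v)%R.
    by apply: le_trans out; rewrite lez_nat leq_double.
  by rewrite /w; move: (imbalance _ _ _) => e; lia.
have := subset_leq_card cover; rewrite cardsT leqNgt => /negP; apply.
have bound : (#|\bigcup_(A in [set A : {set T} | #|A| == n]) bal A| * 2 ^ (3 * n) <=
    2 ^ n.*2.+1 * 2 ^ #|{: {set T}}|)%N.
  apply: (@leq_trans ((\sum_(A in [set A : {set T} | #|A| == n]) #|bal A|) * 2 ^ (3 * n))%N).
    rewrite leq_mul2r; apply/orP; right.
    exact: leq_card_bigcup_sum.
  rewrite big_distrl /=.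
  apply: (@leq_trans (\sum_(A in [set A : {set T} | #|A| == n]) 2 ^ #|{: {set T}}|)%N).
    by apply: leq_sum => A; rewrite inE => /eqP/few.
  rewrite sum_nat_const leq_mul2r; apply/orP; right.
  apply: leq_trans (max_card _) _.
  by rewrite -[#|_|]cardsT -powersetT card_powerset cardsT cT.
rewrite -(@ltn_pmul2r (2 ^ (3 * n))) ?expn_gt0 //; apply: leq_ltn_trans bound _.
have -> : #|{: {set {set T}}}| = (2 ^ #|{: {set T}}|)%N.
  by rewrite -cardsT -powersetT card_powerset cardsT.
by rewrite mulnC ltn_pmul2l ?expn_gt0 // ltn_exp2l //; rewrite /n; lia.
Qed.

Local Open Scope ring_scope.

Lemma dhalf_upper_bound (R : realType) : exists2 K : nat, (0 < K)%N &
  forall s : nat, (16 * K ^ 2 <= s)%N -> (17 <= s)%N ->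
    (4 * K%:R)^-1 * Num.sqrt s%:R <= s%:R / 2 - (dhalf s)%:R :> R.
Proof.
(* An opaque [a] keeps the powers of 2 symbolic. *)
have [a ea] : exists a, a = 64%N by exists 64%N.
have a_gt0 : (0 < a)%N by rewrite ea.
have B_gt0 : (0 < (2 ^ (3 * a).+1) ^ 2)%N by rewrite !expn_gt0.
have gap s := @halving_gap a s (dhalf s) ea.
move: ((2 ^ (3 * a).+1) ^ 2)%N B_gt0 gap => B B_gt0 gap.
have K_gt0 : (0 < 32 * a * B)%N by rewrite !muln_gt0 a_gt0.
exists (32 * a * B)%N => // s; set K := (32 * a * B)%N in K_gt0 * => Ks s17.
have := gap s s17 (dhalfP s).1; set d := dhalf s; set w := (s.+1 - d.*2)%N => gapw.
have {gapw} : (s < (K * w.+1) ^ 2)%N.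
  apply: ltn_trans (ltnSn s) _; apply: leq_trans gapw _; rewrite leq_sqr.
  rewrite mulnCA [leqRHS](_ : _ = 8 * (4 * a * w.+1 * B))%N; last by rewrite /K; lia.
  rewrite mulnCA; do 2?[rewrite leq_mul2l; apply/orP; right].
  by rewrite leq_mul2r; apply/orP; right; nia.
set q : R := Num.sqrt s%:R => sK.
have k0 : 0 < K%:R :> R by rewrite ltr0n.
have qK : q < K%:R * w.+1%:R.
  rewrite -natrM -[ltRHS]ger0_norm // -sqrtr_sqr ltr_sqrt -?natrX ?ltr_nat //.
  by rewrite ltr0n (leq_ltn_trans _ sK).
have qK4 : 4 * K%:R <= q.
  rewrite -[leLHS]ger0_norm ?mulr_ge0 // -sqrtr_sqr ler_wsqrtr //.
  by rewrite -natrM -natrX ler_nat expnMn.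
(* The slack of [w + 1] against twice the gap is absorbed by [q >= 4 * K]. *)
have step : (4 * K%:R)^-1 * q = q / K%:R / 4 by rewrite invfM; lra.
have qKw : q / K%:R < w.+1%:R by rewrite ltr_pdivrMr // mulrC.
have qK1 : 4 <= q / K%:R by rewrite ler_pdivlMr.
rewrite step; have [ds|sd] := leqP d.*2 s.
  have wE : w%:R = s%:R + 1 - d%:R * 2 :> R.
    by rewrite /w natrB ?leqW // -addn1 natrD -muln2 natrM.
  by rewrite -[w.+1]addn1 natrD wE in qKw; lra.
by move: qKw; rewrite (_ : w = 0%N); [lra|rewrite /w; lia].
Qed.

Theorem corollary1p4 (R : realType) :
  exists (c C : R) (s0 : nat),
    [/\ 0 < c, 0 < C &
      forall s : nat, (s0 <= s)%N ->
        c * Num.sqrt s%:R <= s%:R / 2 - (dhalf s)%:R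
        /\ s%:R / 2 - (dhalf s)%:R <= C * Num.sqrt (s%:R * ln s%:R)].
Proof.
have [K K_gt0 upper] := dhalf_upper_bound R.
exists (4 * K%:R)^-1, 8, (16 * K ^ 2 + 64)%N.
split=> // [|s large]; first by rewrite invr_gt0 mulr_gt0 ?ltr0n.
by split; [apply: upper; lia | apply: dhalf_lower_bound; lia].
Qed.
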